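(* \textsc{Long Choice} is PPP-hard: \textsc{Collision} polynomial-time reduces to \textsc{Long Choice}.
   Context: All circuits are Boolean circuits of size polynomial in $n$; $n$-bit strings are identified with integers in $[0,2^n-1]$. A search problem $A$ polynomial-time reduces to a search problem $B$ if there are polynomial-time computable maps $f,g$ such that for every instance $I$ of $A$, $f(I)$ is an instance of $B$, and for every solution $s$ of $f(I)$, $g(I,s)$ is a solution of $I$. \textsc{Collision}: given a poly($n$)-size circuit $C:\{0,1\}^n\to\{0,1\}^n$, find either $x$ with $C(x)=0^n$, or $x\neq y$ with $C(x)=C(y)$. PPP is the class of search problems polynomial-time reducible to \textsc{Collision}; a problem is PPP-hard if \textsc{Collision} reduces to it. \textsc{Long Choice}: Let $U=\{0,1\}^n$. The input is a sequence of predicates $P_0,\dots,P_{n-2}$ given by poly($n$)-size circuits, $P_i:U^{i+2}\to\{0,1\}$. A solution is a sequence of $n+1$ distinct elements $a_0,\dots,a_n\in U$ such that for every $i\in\{0,\dots,n-2\}$, $P_i(a_0,\dots,a_i,a_j)$ is the same for all $j>i$. *)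

(* Defs.v *)
From mathcomp Require Import all_boot.
Set Implicit Arguments. Unset Strict Implicit. Unset Printing Implicit Defensive.

(* Wires 0 .. c_in-1 are the inputs; gate number k defines wire c_in+k. *)
Inductive gate :=
| GConst of bool
| GNot of nat
| GAnd of nat & nat
| GOr of nat & nat.

Record circuit := Circuit { c_in : nat; c_gates : seq gate; c_out : seq nat }.

Definition gate_val (ws : seq bool) (g : gate) : bool :=
  match g with
  | GConst b => b
  | GNot i => ~~ nth false ws i
  | GAnd i j => nth false ws i && nth false ws j
  | GOr i j => nth false ws i || nth false ws j
  end.

Definition gate_wf (k : nat) (g : gate) : bool :=
  match g with
  | GConst _ => true
  | GNot i => i < k
  | GAnd i j | GOr i j => (i < k) && (j < k)
  end.

Definition circuit_wf (C : circuit) : bool :=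
  all (fun p => gate_wf (c_in C + p.1) p.2)
      (zip (iota 0 (size (c_gates C))) (c_gates C))
  && all (fun o => o < c_in C + size (c_gates C)) (c_out C).

Definition circ_eval (C : circuit) (x : seq bool) : seq bool :=
  let ws := foldl (fun ws g => rcons ws (gate_val ws g)) x (c_gates C) in
  [seq nth false ws o | o <- c_out C].

Definition unary (k : nat) : seq bool := rcons (nseq k true) false.

(* self-delimiting encoding of a bit string *)
Definition enc_bits (x : seq bool) : seq bool :=
  flatten [seq [:: true; b] | b <- x] ++ [:: false].

Definition enc_pair (x y : seq bool) : seq bool := enc_bits x ++ y.

Definition enc_gate (g : gate) : seq bool :=
  match g with
  | GConst b => [:: true; true; b]
  | GNot i => [:: true; false] ++ unary i
  | GAnd i j => [:: false; false] ++ unary i ++ unary j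
  | GOr i j => [:: false; true] ++ unary i ++ unary j
  end.

Definition enc_circuit (C : circuit) : seq bool :=
  unary (c_in C) ++ unary (size (c_gates C)) ++ flatten (map enc_gate (c_gates C))
  ++ unary (size (c_out C)) ++ flatten (map unary (c_out C)).

(* Symbol None is the blank.  delta returning None means "halt".        *)
Definition sym := option bool.

Record TM := TMach {
  tm_nq : nat;                      (* states are 'I_(tm_nq.+1), start = ord0 *)
  tm_delta : 'I_tm_nq.+1 -> sym -> option ('I_tm_nq.+1 * sym * bool)
  (* bool = direction of head move: true = right, false = left *)
}.

(* configuration: state, left part of the tape (reversed), the tape from the
   head position onwards (implicitly followed by blanks) *)
Definition config (M : TM) := ('I_(tm_nq M).+1 * seq sym * seq sym)%type.

Definition tm_init (M : TM) (x : seq bool) : config M := (ord0, [::], map Some x).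

Definition tm_halted (M : TM) (c : config M) : bool :=
  tm_delta c.1.1 (head None c.2) == None.

Definition tm_step (M : TM) (c : config M) : config M :=
  let: (q, L, R) := c in
  match tm_delta q (head None R) with
  | None => c
  | Some (q', b, d) =>
      let R1 := b :: behead R in
      if d then (q', b :: L, behead R)
      else match L with
           | [::] => (q', [::], R1)
           | a :: L' => (q', L', a :: R1)
           end
  end.

Definition tm_run (M : TM) (t : nat) (c : config M) : config M := iter t (@tm_step M) c.

Fixpoint tape_word (R : seq sym) : seq bool :=
  match R with
  | Some b :: R' => b :: tape_word R'
  | _ => [::]
  end.

Definition tm_outputs_within (M : TM) (t : nat) (x y : seq bool) : Prop :=
  let c := tm_run t (tm_init M x) in tm_halted c /\ tape_word c.2 = y.

Record search_problem := SearchProblem {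
  sp_inst : Type;
  sp_sol : Type;
  sp_valid : sp_inst -> Prop;
  sp_rel : sp_inst -> sp_sol -> Prop;
  sp_encI : sp_inst -> seq bool;
  sp_encS : sp_sol -> seq bool
}.

Definition poly_reduces (A B : search_problem) : Prop :=
  exists (f : sp_inst A -> sp_inst B) (g : sp_inst A -> sp_sol B -> sp_sol A),
    [/\ (exists (Mf : TM) (k : nat), forall I, sp_valid I ->
           exists t, t <= (size (sp_encI I)).+2 ^ k /\
                     tm_outputs_within Mf t (sp_encI I) (sp_encI (f I))),
        (exists (Mg : TM) (k : nat), forall I s, sp_valid I -> sp_rel (f I) s ->
           exists t, t <= (size (enc_pair (sp_encI I) (sp_encS s))).+2 ^ k /\
                     tm_outputs_within Mg t (enc_pair (sp_encI I) (sp_encS s))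
                                       (sp_encS (g I s))),
        (forall I, sp_valid I -> sp_valid (f I)) &
        (forall I s, sp_valid I -> sp_rel (f I) s -> sp_rel I (g I s))].

Inductive col_sol :=
| ColZero of seq bool
| ColPair of seq bool & seq bool.

Definition col_valid (C : circuit) : Prop :=
  [/\ circuit_wf C & size (c_out C) = c_in C].

Definition col_rel (C : circuit) (s : col_sol) : Prop :=
  let n := c_in C in
  match s with
  | ColZero x => size x = n /\ circ_eval C x = nseq n false
  | ColPair x y => [/\ size x = n, size y = n, x <> y & circ_eval C x = circ_eval C y]
  end.

Definition enc_col_sol (s : col_sol) : seq bool :=
  match s with
  | ColZero x => false :: enc_bits x
  | ColPair x y => true :: enc_bits x ++ enc_bits y
  end.

Definition Collision : search_problem :=
  @SearchProblem circuit col_sol col_valid col_rel enc_circuit enc_col_sol.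

Record lc_inst := LCInst { lc_n : nat; lc_P : seq circuit }.

Definition lc_valid (I : lc_inst) : Prop :=
  let n := lc_n I in
  size (lc_P I) = n.-1 /\
  forall i, i < n.-1 ->
    let P := nth (Circuit 0 [::] [::]) (lc_P I) i in
    [/\ circuit_wf P, c_in P = (i + 2) * n & size (c_out P) = 1].

Definition lc_rel (I : lc_inst) (a : seq (seq bool)) : Prop :=
  let n := lc_n I in
  let P i := nth (Circuit 0 [::] [::]) (lc_P I) i in
  [/\ size a = n.+1, (forall j, j <= n -> size (nth [::] a j) = n), uniq a &
      forall i, i < n.-1 ->
        forall j k, i < j <= n -> i < k <= n ->
          circ_eval (P i) (flatten (take i.+1 a) ++ nth [::] a j)
          = circ_eval (P i) (flatten (take i.+1 a) ++ nth [::] a k)].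

Definition enc_lc_inst (I : lc_inst) : seq bool :=
  unary (lc_n I) ++ unary (size (lc_P I)) ++ flatten (map enc_circuit (lc_P I)).

Definition enc_lc_sol (a : seq (seq bool)) : seq bool :=
  unary (size a) ++ flatten (map enc_bits a).

Definition LongChoice : search_problem :=
  @SearchProblem lc_inst (seq (seq bool)) lc_valid lc_rel enc_lc_inst enc_lc_sol.

(* Main.v *)
Require Import Defs.
From mathcomp Require Import all_boot.
From mathcomp Require Import zify.
Set Implicit Arguments. Unset Strict Implicit. Unset Printing Implicit Defensive.

(** The elements of the Long Choice instance are the inputs of [C], and the
    predicates run a Gaussian elimination over GF(2). With r_0(x) = C(x) and
    c_s = r_s(a_s), the predicate P_s(a_0, .., a_s, x) is the bit of r_s(x) at a
    pivot of c_s, and r_(s+1)(x) = r_s(x) + P_s(a_0, .., a_s, x) c_s. If the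
    values C(a_0), .., C(a_n) were nonzero and pairwise distinct, then so would
    be the r_s(a_j) with j >= s, because the a_j with j > s agree on P_s; but
    after n - 1 stages r(a_(n-1)) and r(a_n) lie in a space of dimension one.
    So a solution contains a zero or a collision of [C], found by evaluation.

    Polynomial-time computability is reduced to closure properties: trees
    serialised on top of a stack are manipulated by programs which act on four
    stacks, and these stacks are stored one after the other on the tape. *)

(** * Flat machine code and structured tape programs *)

(** There are [n - 1] predicates, one fewer than the bits of [C(x)]. Asking for these bits one at a
    time could leave [a_(n-1)] and [a_n] with values that differ in the last bit, neither of them
    zero. Elimination makes up for the missing bit by excluding zero at every stage. Where the pivot
    bit is 0 the vector is unchanged; where it is 1 it becomes [r_s(x) + c_s], which is nonzero
    because [r_s(x)] differs from [c_s]. Either answer turns the [2^d - 1] nonzero vectors of the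
    current space into [2^(d-1) - 1], and in dimension one a single nonzero vector is left. The
    construction relies on [P_s] seeing [a_0, .., a_s], from which the pivot of [c_s] is computed.
    On the machine side, a left move at the left end of the tape goes unnoticed, so a blank is put
    there as a marker. The machines receive strings, so the reduction is composed with decoders that
    are total on strings. *)

Definition tape := (seq sym * seq sym)%type.

Definition tape_move (b : sym) (d : bool) (T : tape) : tape :=
  let: (L, R) := T in
  if d then (b :: L, behead R)
  else if L is a :: L' then (L', a :: b :: behead R) else ([::], b :: behead R).

(* The last component is the address of the next instruction; the machine
   halts when it reaches the address [size c]. *)
Definition instr := sym -> sym * bool * nat.

Definition tm_of_code (c : seq instr) : TM :=
  @TMach (size c) (fun q s =>
    if q < size c then
      let: (b, d, pc) := nth (fun=> (None, true, 0)) c q s in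
      Some (inord pc, b, d)
    else None).

Definition cfg (c : seq instr) (pc : nat) (T : tape) : config (tm_of_code c) :=
  (inord pc, T.1, T.2).

Lemma tm_step_cfg c pc T : pc < size c ->
  let: (b, d, pc') := nth (fun=> (None, true, 0)) c pc (head None T.2) in
  tm_step (cfg c pc T) = cfg c pc' (tape_move b d T).
Proof.
case: T => L R lt_pc; rewrite /tm_step /cfg /= inordK; last exact: ltnW.
by rewrite lt_pc; case: (nth _ _ _ _) => [[b []] pc'] //=; case: L.
Qed.

(* [TLp] repeats one instruction while the symbol just read satisfies the
   condition; [TBr] and [TWh] act on the head symbol before branching on it. *)
Inductive tprog :=
| TLp of (sym -> bool) & (sym -> sym * bool)
| TIns of bool
| TSeq of tprog & tprog
| TBr of (sym -> sym * bool) & tprog & tprog & tprog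
| TWh of (sym -> bool) & (sym -> sym * bool) & tprog.

Fixpoint plen (p : tprog) : nat :=
  match p with
  | TLp _ _ => 1
  | TIns _ => 2
  | TSeq p q => plen p + plen q
  | TBr _ p q r => (plen p + plen q + plen r).+1
  | TWh _ _ p => (plen p).+1
  end.

Definition sym_case {A : Type} (n f t : A) (s : sym) : A :=
  match s with None => n | Some false => f | Some true => t end.

(** [base] is the address of the first instruction and [exit] the address at which to continue. The
    two instructions of [TIns] form a one-bit buffer: the first writes [b], the second [~~ b], and
    each jumps to the one that will write the bit it has just overwritten. *)
Fixpoint compile (p : tprog) (base exit : nat) : seq instr :=
  match p with
  | TLp c a => [:: fun s => (a s, if c s then base else exit)]
  | TIns b =>
    [:: fun s => (Some b, true, if s is Some b' then base + (b != b') else exit);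
        fun s => (Some (~~ b), true, if s is Some b' then base + (b != b') else exit)]
  | TSeq p q => compile p base (base + plen p) ++ compile q (base + plen p) exit
  | TBr a p q r =>
    let b2 := base.+1 + plen p in let b3 := b2 + plen q in
    (fun s => (a s, sym_case base.+1 b2 b3 s)) ::
    compile p base.+1 exit ++ compile q b2 exit ++ compile r b3 exit
  | TWh c a p =>
    (fun s => (a s, if c s then base.+1 else exit)) :: compile p base.+1 base
  end.

Lemma size_compile p base exit : size (compile p base exit) = plen p.
Proof.
elim: p base exit => //= [p IHp q IHq|a p IHp q IHq r IHr|c a p IHp] base exit;
  rewrite ?size_cat ?IHp ?IHq ?IHr //; lia.
Qed.

Definition code_at (c : seq instr) (base : nat) (d : seq instr) :=
  exists c1 c2, c = c1 ++ d ++ c2 /\ size c1 = base.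

Lemma code_at_cat c base d1 d2 :
  code_at c base (d1 ++ d2) -> code_at c base d1 /\ code_at c (base + size d1) d2.
Proof.
move=> [c1 [c2 [-> <-]]]; split; first by exists c1, (d2 ++ c2); rewrite !catA.
by exists (c1 ++ d1), c2; rewrite !catA size_cat.
Qed.

Lemma code_at_cons c base i d :
  code_at c base (i :: d) -> code_at c base [:: i] /\ code_at c base.+1 d.
Proof. by rewrite -cat1s => /code_at_cat; rewrite addn1. Qed.

Lemma code_at_step c base i T : code_at c base [:: i] ->
  tm_run 1 (cfg c base T) = cfg c (i (head None T.2)).2
    (tape_move (i (head None T.2)).1.1 (i (head None T.2)).1.2 T).
Proof.
move=> [c1 [c2 [-> <-]]].
have lt_b : size c1 < size (c1 ++ [:: i] ++ c2) by rewrite !size_cat /=; lia.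
have := tm_step_cfg T lt_b; rewrite nth_cat ltnn subnn /=.
by case: (i _) => [[b d] pc].
Qed.

(** Quantifying over the surrounding code and both addresses makes this compositional. As [n] is
    only an upper bound, time estimates can be rounded up freely. *)
Definition runs (p : tprog) (T T' : tape) (n : nat) : Prop :=
  forall c base exit, code_at c base (compile p base exit) ->
  exists2 t, t <= n & tm_run t (cfg c base T) = cfg c exit T'.

Lemma runs_le p T T' n n' : n <= n' -> runs p T T' n -> runs p T T' n'.
Proof.
move=> le_n H c base exit /H [t le_t run].
by exists t => //; apply: leq_trans le_t le_n.
Qed.

Definition do_act (a : sym -> sym * bool) (T : tape) : tape :=
  tape_move (a (head None T.2)).1 (a (head None T.2)).2 T.

Lemma runs_seq p q T1 T2 T3 n m :
  runs p T1 T2 n -> runs q T2 T3 m -> runs (TSeq p q) T1 T3 (n + m).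
Proof.
move=> Hp Hq c base exit /= /code_at_cat [/Hp [t le_t run]].
rewrite size_compile => /Hq [t' le_t' run'].
exists (t' + t); first by lia.
by rewrite /tm_run iterD -/(tm_run t _) run.
Qed.

Lemma runs_act (cnd : sym -> bool) a T : cnd (head None T.2) = false ->
  runs (TLp cnd a) T (do_act a T) 1.
Proof.
move=> Hc c base exit /= /code_at_step run.
by exists 1 => //; rewrite run /do_act /=; case: (a _) => ? ?; rewrite Hc.
Qed.

Lemma runs_lp (cnd : sym -> bool) a (T : tape) T' n : cnd (head None T.2) ->
  runs (TLp cnd a) (do_act a T) T' n -> runs (TLp cnd a) T T' n.+1.
Proof.
move=> Hc H c base exit Hcode; have /code_at_step run := Hcode.
have [t le_t run'] := H _ _ _ Hcode.
exists (t + 1); first by lia.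
rewrite /tm_run iterD -/(tm_run 1 _) run /= -run' /do_act /=.
by case: (a _) => ? ?; rewrite Hc.
Qed.

Lemma runs_br a p q r T T' n :
  runs (sym_case p q r (head None T.2)) (do_act a T) T' n ->
  runs (TBr a p q r) T T' n.+1.
Proof.
move=> H c base exit /= /code_at_cons [/code_at_step run].
case/code_at_cat => + /code_at_cat []; rewrite !size_compile => Hp Hq Hr.
have [t le_t run'] : exists2 t, t <= n & tm_run t (cfg c (sym_case base.+1
   (base.+1 + plen p) (base.+1 + plen p + plen q) (head None T.2)) (do_act a T)) = cfg c exit T'.
  by move: H; rewrite /sym_case; case: (head None T.2) => [[]|] H; apply: H.
exists (t + 1); first by lia.
rewrite /tm_run iterD -/(tm_run 1 _) run /= -run' /do_act /=.
by case: (a _).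
Qed.

Lemma runs_wh_end (cnd : sym -> bool) a p T : cnd (head None T.2) = false ->
  runs (TWh cnd a p) T (do_act a T) 1.
Proof.
move=> Hc c base exit /= /code_at_cons [/code_at_step run _].
by exists 1 => //; rewrite run /do_act /=; case: (a _) => ? ?; rewrite Hc.
Qed.

Lemma runs_wh (cnd : sym -> bool) a p T T1 T' n m : cnd (head None T.2) ->
  runs p (do_act a T) T1 n -> runs (TWh cnd a p) T1 T' m ->
  runs (TWh cnd a p) T T' (n + m).+1.
Proof.
move=> Hc Hp H c base exit Hcode; have /code_at_cons [/code_at_step run Hcp] := Hcode.
have [t le_t run'] := Hp _ _ _ Hcp; have [t2 le_t2 run2] := H _ _ _ Hcode.
exists (t2 + (t + 1)); first by lia.
rewrite /tm_run 2!iterD -/(tm_run 1 _) run /= -run2 -run' /tm_run /do_act /=.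
by case: (a _) => ? ?; rewrite Hc.
Qed.

Definition somes (w : seq bool) : seq sym := map Some w.
Definition blanks (m : nat) : seq sym := nseq m None.

Lemma runs_ins b w L m :
  runs (TIns b) (L, somes w ++ blanks m) (rev (somes (b :: w)) ++ L, blanks m.-1) (size w).+1.
Proof.
(* Generalised over the bit [b'] still to be written, which the current address records. *)
suff H b' c base exit : code_at c base (compile (TIns b) base exit) ->
  tm_run (size w).+1 (cfg c (base + (b != b')) (L, somes w ++ blanks m))
  = cfg c exit (rev (somes (b' :: w)) ++ L, blanks m.-1).
  by move=> c base exit /(H b) run; exists (size w).+1; rewrite // -run eqxx addn0.
move=> /= /code_at_cons [H0 H1].
have step (b1 : bool) T : tm_run 1 (cfg c (base + (b != b1)) T) =
    cfg c (if head None T.2 is Some b2 then base + (b != b2) else exit)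
      (tape_move (Some b1) true T).
  have [<-|] := eqVneq b b1; first by rewrite addn0 (code_at_step _ H0).
  rewrite eq_sym => /negPf neq_b; rewrite addn1 (code_at_step _ H1) /=.
  by case: b b1 neq_b {H0 H1} => [] [].
elim: w b' L => [|b2 w IHw] b' L; first by rewrite [LHS]step /=; case: (m).
rewrite -[X in tm_run X]addn1 /tm_run iterD -/(tm_run 1 _) -/(tm_run _ _) step /=.
by rewrite IHw ?map_cons !rev_cons !cat_rcons.
Qed.

Lemma tm_of_tprog p x T' n : runs p ([::], somes x) T' n ->
  exists2 t, t <= n & tm_outputs_within (tm_of_code (compile p 0 (plen p))) t x (tape_word T'.2).
Proof.
set c := compile _ _ _ => H.
have /H [t le_t run] : code_at c 0 c by exists [::], [::]; rewrite cats0.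
exists t => //; rewrite /tm_outputs_within.
have -> : tm_init (tm_of_code c) x = cfg c 0 ([::], somes x).
  by rewrite /tm_init /cfg; congr (_, _, _); apply/val_inj; rewrite /= inordK.
rewrite run /tm_halted /cfg /=; split => //.
by rewrite inordK size_compile // ltnn.
Qed.

(** * Stacks on a tape *)

Definition keep (d : sym -> bool) (s : sym) : sym * bool := (s, d s).

Definition at_pos (F : seq sym) (p : nat) : tape := (rev (take p F), drop p F).

Lemma at_pos_right F p (d : sym -> bool) : p < size F -> d (nth None F p) ->
  do_act (keep d) (at_pos F p) = at_pos F p.+1.
Proof.
move=> lt_p dp; rewrite /do_act /= (drop_nth None lt_p) /= dp.
by rewrite /at_pos (take_nth None lt_p) rev_rcons.
Qed.

Lemma at_pos_left F p (d : sym -> bool) : p.+1 < size F -> d (nth None F p.+1) = false ->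
  do_act (keep d) (at_pos F p.+1) = at_pos F p.
Proof.
move=> lt_p dp; rewrite /do_act /= (drop_nth None lt_p) /= dp.
rewrite (take_nth None (ltnW lt_p)) rev_rcons /= /at_pos.
by rewrite (drop_nth None (ltnW lt_p)) (drop_nth None lt_p).
Qed.

Definition go_right := TLp xpred0 (keep xpredT).
Definition go_left := TLp xpred0 (keep xpred0).
Definition rewind := TLp isSome (keep (fun s => ~~ isSome s)).

(** The blank in cell 0 is the left end marker at which [rewind] turns round. The [m] trailing
    blanks are explicit cells of the tape; their number depends on the history of the run, so later
    statements only assert that some number exists. *)
Definition full_tape (w : seq bool) (m : nat) : seq sym := None :: somes w ++ blanks m.
Lemma size_full_tape w m : size (full_tape w m) = (size w + m).+1.
Proof. by rewrite /= size_cat size_map size_nseq. Qed.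

Definition home (w : seq bool) (m : nat) : tape := at_pos (full_tape w m) 1.

Lemma nth_somes w m i : i < size w -> nth None (somes w ++ blanks m) i = Some (nth false w i).
Proof. by move=> lt_i; rewrite nth_cat size_map lt_i (nth_map false). Qed.

Lemma nth_full_tape w m i : i < size w -> nth None (full_tape w m) i.+1 = Some (nth false w i).
Proof. exact: nth_somes. Qed.

Lemma runs_rewind w m p : p <= size w ->
  runs rewind (at_pos (full_tape w m) p) (home w m) p.+1.
Proof.
elim: p => [|p IHp] le_p; first by rewrite /home -(@at_pos_right _ 0 (fun s => ~~ isSome s)) //; apply: runs_act.

have lt_p : p.+1 < size (full_tape w m) by rewrite /= size_cat size_map; lia.
apply: runs_lp; first by rewrite -nth0 nth_drop addn0 /= nth_somes.
by rewrite at_pos_left //= ?nth_somes //; apply: IHp; apply: ltnW.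
Qed.

Lemma runs_right F p : p < size F -> runs go_right (at_pos F p) (at_pos F p.+1) 1.
Proof. by move=> lt_p; rewrite -(@at_pos_right F p xpredT lt_p) //; apply: runs_act. Qed.

Lemma runs_left F p : p.+1 < size F -> runs go_left (at_pos F p.+1) (at_pos F p) 1.
Proof. by move=> lt_p; rewrite -(@at_pos_left F p xpred0 lt_p) //; apply: runs_act. Qed.

Lemma head_at_pos F p : head None (at_pos F p).2 = nth None F p.
Proof. by rewrite -nth0 nth_drop addn0. Qed.

Definition is_one (s : sym) : bool := s == Some true.

(** The loop reads the announcing symbol of each pair in [enc_bits] and [go_right] passes over the
    data bit; the closing [false] ends the loop. *)
Definition skip1 := TWh is_one (keep xpredT) go_right.
Definition skip i (p : tprog) := iter i (TSeq skip1) p.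

Lemma drop_nth_size (F : seq sym) p s r : drop p F = s :: r ->
  [/\ p < size F, nth None F p = s & drop p.+1 F = r].
Proof.
move=> def_F; have lt_p : p < size F.
  by rewrite ltnNge -subn_eq0 -size_drop def_F.
by move: def_F; rewrite (drop_nth None lt_p) => -[-> ->].
Qed.

Lemma runs_skip1 F p x r : drop p F = somes (enc_bits x) ++ r ->
  runs skip1 (at_pos F p) (at_pos F (p + size (enc_bits x))) (size (enc_bits x)).
Proof.
elim: x p => [|b x IHx] p /drop_nth_size [lt_p nth_p].
  move=> _; rewrite addn1 -(@at_pos_right F p xpredT) //.
  by apply: runs_wh_end; rewrite head_at_pos nth_p.
move/drop_nth_size => [lt_p1 nth_p1 /IHx IH].
rewrite [size _]/= !addnS -!addSn; apply: (runs_wh (n := 1)) IH; first by rewrite head_at_pos nth_p.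
by rewrite at_pos_right //; apply: runs_right.
Qed.

Definition encs (l : seq (seq bool)) := flatten (map enc_bits l).

Lemma runs_skip F p l r q T' n : drop p F = somes (encs l) ++ r ->
  runs q (at_pos F (p + size (encs l))) T' n ->
  runs (skip (size l) q) (at_pos F p) T' (size (encs l) + n).
Proof.
elim: l p => [|x l IHl] p def_F Hq; first by rewrite addn0 in Hq.
move: def_F Hq; rewrite /= /encs /= -/(encs l) /somes map_cat -catA size_cat addnA -[_ + _ + n]addnA => def_F Hq.
apply: (runs_seq (runs_skip1 def_F)); apply: IHl Hq.
by rewrite addnC -drop_drop def_F drop_size_cat // size_map.
Qed.

(** The left move leaves the blank that follows the word, on which [rewind] would stop at once. *)
Definition back := TSeq go_left rewind.

Lemma runs_back w m p : p <= size w ->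
  runs back (at_pos (full_tape w m.+1) p.+1) (home w m.+1) p.+2.
Proof.
move=> le_p; apply: (@runs_seq _ _ _ _ _ 1); last exact: runs_rewind.
by apply: runs_left; rewrite /= size_cat size_map /= size_nseq; lia.
Qed.

Lemma drop_encs l v m : drop 1 (full_tape (encs l ++ v) m) = somes (encs l) ++ somes v ++ blanks m.
Proof. by rewrite /full_tape /= drop0 /somes map_cat -catA. Qed.

Lemma tape_left_end w x R : do_act (keep xpred0) (rev (None :: somes (rcons w x)), R)
  = at_pos (None :: somes (rcons w x) ++ head None R :: behead R) (size w).+1.
Proof.
rewrite /do_act /at_pos /somes map_rcons rev_cons rev_rcons /= cat_rcons.
by rewrite take_size_cat ?drop_size_cat ?size_map // rev_cons.
Qed.

Lemma at_pos_split u v m :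
  at_pos (full_tape (u ++ v) m) (1 + size u) = (rev (None :: somes u), somes v ++ blanks m).
Proof.
by rewrite /at_pos /full_tape add1n /somes map_cat -catA /= take_size_cat ?drop_size_cat ?size_map.
Qed.

Definition insert_at i b := TSeq (skip i (TIns b)) back.

Lemma runs_insert l b v m : exists m',
  runs (insert_at (size l) b) (home (encs l ++ v) m) (home (encs l ++ b :: v) m'.+1)
     (3 * (size (encs l ++ v)).+2).
Proof.
have [w [x def_w]] : exists w x, encs l ++ b :: v = rcons w x.
  case/lastP: (encs l ++ b :: v) (size_cat (encs l) (b :: v)) => [|w x _].
    by rewrite addnS.
  by exists w, x.
have Hins := @runs_ins b v (rev (None :: somes (encs l))) m.
rewrite -at_pos_split in Hins.
have {}Hins := runs_skip (drop_encs l v m) Hins.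
have eqL : rev (somes (b :: v)) ++ rev (None :: somes (encs l)) = rev (None :: somes (rcons w x)).
  by rewrite -rev_cat -def_w /somes map_cat.
rewrite eqL in Hins.
(* The insertion uses up one blank if there is one. The left move of [back] then writes the blank
   under the head, so at least one explicit blank follows the word, even for small [m]. *)
exists m.-2; rewrite def_w.
apply: runs_le (runs_seq Hins (_ : runs _ _ _ (size w).+3)).
  by have := congr1 size def_w; rewrite size_rcons !size_cat /=; lia.
apply: (@runs_seq _ _ _ _ _ 1); last first.
  by apply: (@runs_rewind (rcons w x) m.-2.+1 (size w).+1); rewrite size_rcons.
have -> : full_tape (rcons w x) m.-2.+1 =
    None :: somes (rcons w x) ++ head None (blanks m.-1) :: behead (blanks m.-1).
  by case: m {eqL Hins} => [|[]].
by rewrite -tape_left_end; apply: runs_act.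
Qed.

Definition write_right b := TLp xpred0 (fun=> (b, true)).

Definition delete_body :=
  TBr (keep xpred0) (write_right None) (write_right (Some false)) (write_right (Some true)).

(** Each round looks one cell ahead and copies what it finds one cell to the left. Copying the blank
    after the word ends the loop, whose last left move puts the head on the copied blank, where
    [back] can take over. *)
Definition delete_here := TWh isSome (keep isSome) delete_body.

Lemma runs_delete_body a L R :
  runs delete_body (a :: L, R) (head None R :: L, head None R :: behead R) 2.
Proof. by apply: runs_br; case: R => [|[[]|] R]; apply: runs_act. Qed.

Lemma runs_delete a w L m : exists m',
  runs delete_here (L, somes (a :: w) ++ blanks m) (rev (somes w) ++ L, None :: blanks m') (3 * (size w).+1).+1.
Proof.
exists m.-1.+1; elim: w a L => [|b w IHw] a L.
  apply: (runs_wh (n := 2)) => //; first exact: runs_delete_body.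
  by case: m => [|m]; apply: runs_wh_end.
rewrite [3 * _]mulnS; apply: (runs_wh (n := 2)) => //; first exact: runs_delete_body.
by have := IHw b (Some b :: L); rewrite /= rev_cons cat_rcons.
Qed.

Definition delete_at i := TSeq (skip i delete_here) back.

Lemma runs_delete_at l a v m : exists m',
  runs (delete_at (size l)) (home (encs l ++ a :: v) m) (home (encs l ++ v) m'.+1)
     (6 * (size (encs l ++ v)).+2).
Proof.
have [m' Hdel] := @runs_delete a v (rev (None :: somes (encs l))) m.
rewrite -at_pos_split in Hdel.
have {}Hdel := runs_skip (drop_encs l (a :: v) m) Hdel.
rewrite -rev_cat cat_cons -map_cat in Hdel.
have Epos : at_pos (full_tape (encs l ++ v) m'.+1) (size (encs l ++ v)).+1
   = (rev (None :: somes (encs l ++ v)), None :: blanks m').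
  by have := at_pos_split (encs l ++ v) [::] m'.+1; rewrite cats0.
exists m'; rewrite -Epos in Hdel.
apply: runs_le (runs_seq Hdel (runs_back _ (leqnn _))).
by rewrite !size_cat; lia.
Qed.

(** * Programs that act on four stacks *)

Definition state := seq (seq bool).

(* Stacks 0, 1, 2 are stored self-delimited; stack 3, the last one, is raw, so
   that it can hold the input and the output of the machine. *)
Definition word (s : state) : seq bool := encs (take 3 s) ++ nth [::] s 3.

Definition top_is (t : bool) (i : nat) (s : state) : bool :=
  if t then head false (nth [::] s i) else nth [::] s i != [::].

(** On a self-delimited stack both tests look for [true]: nonemptiness in the announcing symbol, the
    top bit in the data cell after it. Only the raw stack shows its emptiness by a blank. *)
Definition cell_test (t : bool) (i : nat) : sym -> bool :=
  if t || (i < 3) then is_one else isSome.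

(** Every instruction moves the head, so a program that leaves the tape as it is needs two moves. *)
Definition stay := TSeq go_left go_right.

(** To reach the top bit, the branch moves right if [true] announces one; otherwise it moves left,
    and [go_right] undoes this. *)
Definition goto (t : bool) (i : nat) : tprog :=
  skip i (if t && (i < 3) then TBr (keep is_one) go_right go_right stay else stay).

Definition goto_pos (t : bool) (i : nat) (s : state) : nat :=
  size (encs (take i s)) + (t && (i < 3) && (nth [::] s i != [::])).

Lemma runs_stay F p : p.+1 < size F -> runs stay (at_pos F p.+1) (at_pos F p.+1) 2.
Proof.
move=> lt_p; apply: (@runs_seq _ _ _ _ _ 1 1); first exact: runs_left.
by apply: runs_right; apply: ltnW.
Qed.

Lemma runs_goto_enc t l x v m :
  let F := full_tape (encs l ++ enc_bits x ++ v) m.+1 in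
  let p := size (encs l) + (t && (x != [::])) in
  runs (skip (size l) (if t then TBr (keep is_one) go_right go_right stay else stay))
     (home (encs l ++ enc_bits x ++ v) m.+1) (at_pos F p.+1) (size (encs l) + 3)
  /\ is_one (nth None F p.+1) = (if t then head false x else x != [::]).
Proof.
move=> F p.
have ltF : p.+1 < size F.
  rewrite size_full_tape !size_cat /p.
  by case: (x) (t) => [|b y] [] /=; rewrite ?size_cat /=; lia.
have nthF k : k < size (enc_bits x) -> nth None F (size (encs l) + k).+1 = Some (nth false (enc_bits x) k).
  move=> lt_k; rewrite nth_full_tape; last by rewrite 2!size_cat; lia.
  by rewrite nth_cat ltnNge leq_addr /= addKn nth_cat lt_k.
split; last first.
  by rewrite /p nthF; case: (x) (t) => [|[] y] [].
apply: runs_skip; first by rewrite drop_encs.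
rewrite add1n -/F; case: t @p ltF => p ltF; last by move: ltF; rewrite /p /= addn0 => ltF; apply: (@runs_le _ _ _ 2) => //; apply: runs_stay.
apply: (runs_br (n := 2)).
have := nthF 0; rewrite head_at_pos addn0 => ->; last by case: (x).
case: (x) @p ltF nthF => [|b y] p ltF nthF.
  have := ltF; rewrite /p addn0 => ltF'.
  rewrite at_pos_left //; last by have := nthF 0 isT; rewrite addn0 => ->.
  by apply: (runs_le (n := 1)) => //; apply: runs_right; apply: ltnW.
rewrite at_pos_right; first by rewrite /p addn1 in ltF *; apply: runs_stay.
  by rewrite /p addn1 in ltF; apply: ltnW.
by have := nthF 0 isT; rewrite addn0 => ->.
Qed.

Lemma runs_goto_raw l v m :
  let F := full_tape (encs l ++ v) m.+1 in
  runs (skip (size l) stay) (home (encs l ++ v) m.+1) (at_pos F (size (encs l)).+1) (size (encs l) + 3)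
  /\ nth None F (size (encs l)).+1 = ohead v.
Proof.
move=> F; split; last first.
  rewrite /F /= /somes map_cat -catA nth_cat size_map ltnn subnn.
  by case: v {F}.
apply: runs_skip; first by rewrite drop_encs.
apply: runs_le (runs_stay _) => //.
by rewrite size_full_tape size_cat; lia.
Qed.

Lemma runs_goto t i s m : size s = 4 -> i < 4 ->
  let F := full_tape (word s) m.+1 in
  [/\ runs (goto t i) (home (word s) m.+1) (at_pos F (goto_pos t i s).+1) (size (word s) + 3),
      goto_pos t i s <= size (word s)
    & cell_test t i (nth None F (goto_pos t i s).+1) = top_is t i s].
Proof.
move=> sz_s lt_i F; have [lt_i3|] := ltnP i 3; last first.
  move=> ge_i3; have Ei : i = 3 by lia.
  rewrite {}Ei {lt_i ge_i3 i} in F *.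
  have sz3 : size (take 3 s) = 3 by rewrite size_take sz_s.
  have [] := runs_goto_raw (take 3 s) (nth [::] s 3) m.
  rewrite sz3 -/(word s) -/F /goto_pos /goto ltnn andbF addn0 => Htr Hnth.
  have le_w : size (encs (take 3 s)) <= size (word s) by rewrite size_cat leq_addr.
  split => //; first by apply: runs_le Htr; rewrite leq_add2r.
  by rewrite Hnth /cell_test /top_is orbF; case: t => //; case: (nth _ _ _) => [|[] ?].
have def_s : word s = encs (take i s) ++ enc_bits (nth [::] s i) ++ encs (drop i.+1 (take 3 s)) ++ nth [::] s 3.
  rewrite /word -{1}(cat_take_drop i (take 3 s)) take_takel 1?ltnW //.
  rewrite (drop_nth [::]) ?size_take ?sz_s // nth_take // /encs map_cat flatten_cat /=.
  by rewrite !catA.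
have := runs_goto_enc t (take i s) (nth [::] s i) (encs (drop i.+1 (take 3 s)) ++ nth [::] s 3) m.
rewrite -def_s size_takel; last by lia.
case; rewrite -/F /goto /goto_pos /cell_test lt_i3 andbT orbT => Htr ->; split=> //.
  by apply: runs_le Htr; rewrite leq_add2r def_s size_cat leq_addr.
rewrite def_s 2!size_cat leq_add2l.
by case: (nth _ _ _) (t) => [|? ?] [].
Qed.

(** Here [n] is an abstract cost: a unit adds at most two cells, as a push on a self-delimited stack
    does, and takes at most [20 * N.+1] machine steps, where [N] bounds the length of the word
    during the whole run. Leaving [N] free lets consecutive programs share one bound. The successors
    [m.+1] and [m'.+1] guarantee an explicit blank after the word. *)
Definition exec (p : tprog) (s s' : state) (n : nat) : Prop :=
  [/\ size s' = size s, size (word s') <= size (word s) + 2 * n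
    & forall m N, size (word s) + 2 * n <= N ->
      exists m', runs p (home (word s) m.+1) (home (word s') m'.+1) (n * (20 * N.+1))].

Lemma exec_le p s s' n n' : n <= n' -> exec p s s' n -> exec p s s' n'.
Proof.
move=> le_n [sz_s le_w H]; split=> //; first by lia.
move=> m N le_N; have [|m' Htr] := H m N; first by lia.
by exists m'; apply: runs_le Htr; rewrite leq_mul2r le_n orbT.
Qed.

Lemma exec_seq p q s1 s2 s3 n m : exec p s1 s2 n -> exec q s2 s3 m -> exec (TSeq p q) s1 s3 (n + m).
Proof.
move=> [sz1 le1 H1] [sz2 le2 H2]; split; [by rewrite sz2 | by lia | ].
move=> k N le_N; have [|k1 Htr1] := H1 k N; first by lia.
have [|k2 Htr2] := H2 k1 N; first by lia.
by exists k2; rewrite mulnDl; apply: runs_seq Htr1 Htr2.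
Qed.

Definition set_stack (s : state) i x : state := set_nth [::] s i x.

Definition push i b : tprog :=
  if i < 3 then TSeq (insert_at i b) (insert_at i true) else insert_at 3 b.

Definition pop i : tprog :=
  if i < 3 then TSeq (delete_at i) (delete_at i) else delete_at 3.

Lemma exec_insert l b v s s' : word s = encs l ++ v -> word s' = encs l ++ b :: v ->
  size s' = size s -> exec (insert_at (size l) b) s s' 1.
Proof.
move=> Es Es' sz; split=> //; rewrite Es Es'; first by rewrite !size_cat /=; lia.
move=> m N le_N; have [m' Htr] := runs_insert l b v m.+1.
by exists m'; apply: runs_le Htr; lia.
Qed.

Lemma exec_insert2 l b v s s' : word s = encs l ++ v -> word s' = encs l ++ true :: b :: v ->
  size s' = size s -> exec (TSeq (insert_at (size l) b) (insert_at (size l) true)) s s' 1.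
Proof.
move=> Es Es' sz; split=> //; rewrite Es Es'; first by rewrite !size_cat /=; lia.
move=> m N le_N; have [m1 Htr1] := runs_insert l b v m.+1.
have [m2 Htr2] := runs_insert l true (b :: v) m1.+1.
exists m2; apply: runs_le (runs_seq Htr1 Htr2).
by move: le_N; rewrite !size_cat /=; lia.
Qed.

Lemma exec_delete l a v s s' : word s = encs l ++ a :: v -> word s' = encs l ++ v ->
  size s' = size s -> exec (delete_at (size l)) s s' 1.
Proof.
move=> Es Es' sz; split=> //; rewrite Es Es'; first by rewrite !size_cat /=; lia.
move=> m N le_N; have [m' Htr] := runs_delete_at l a v m.+1.
by exists m'; apply: runs_le Htr; move: le_N; rewrite !size_cat /=; lia.
Qed.

Lemma exec_delete2 l a b v s s' : word s = encs l ++ a :: b :: v -> word s' = encs l ++ v ->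
  size s' = size s -> exec (TSeq (delete_at (size l)) (delete_at (size l))) s s' 1.
Proof.
move=> Es Es' sz; split=> //; rewrite Es Es'; first by rewrite !size_cat /=; lia.
move=> m N le_N; have [m1 Htr1] := runs_delete_at l a (b :: v) m.+1.
have [m2 Htr2] := runs_delete_at l b v m1.+1.
exists m2; apply: runs_le (runs_seq Htr1 Htr2).
by move: le_N; rewrite !size_cat /=; lia.
Qed.

Lemma exec_push i b s : size s = 4 -> i < 4 ->
  exec (push i b) s (set_stack s i (b :: nth [::] s i)) 1.
Proof.
case: s => [|x0 [|x1 [|x2 [|x3 []]]]] // _; case: i => [|[|[|[|//]]]] _; rewrite /push /=.
- by apply: (@exec_insert2 [::] b (encs [:: x0; x1; x2] ++ x3)).
- by apply: (@exec_insert2 [:: x0] b (encs [:: x1; x2] ++ x3)); rewrite ?/word ?/encs ?/enc_bits /= ?cats0; do ?rewrite -?catA /=.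
- by apply: (@exec_insert2 [:: x0; x1] b (encs [:: x2] ++ x3)); rewrite ?/word ?/encs ?/enc_bits /= ?cats0; do ?rewrite -?catA /=.
- by apply: (@exec_insert [:: x0; x1; x2] b x3).
Qed.

Lemma exec_pop i a x s : size s = 4 -> i < 4 -> nth [::] s i = a :: x ->
  exec (pop i) s (set_stack s i x) 1.
Proof.
case: s => [|x0 [|x1 [|x2 [|x3 []]]]] // _; case: i => [|[|[|[|//]]]] _ /= ->; rewrite /pop /=.
- by apply: (@exec_delete2 [::] true a (encs [:: x; x1; x2] ++ x3)).
- by apply: (@exec_delete2 [:: x0] true a (encs [:: x; x2] ++ x3)); rewrite ?/word ?/encs ?/enc_bits /= ?cats0; do ?rewrite -?catA /=.
- by apply: (@exec_delete2 [:: x0; x1] true a (encs [:: x] ++ x3)); rewrite ?/word ?/encs ?/enc_bits /= ?cats0; do ?rewrite -?catA /=.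
- by apply: (@exec_delete [:: x0; x1; x2] a x).
Qed.

(** The test moves the head left before [rewind], because the tested cell may be the blank after the
    word, namely when the raw stack is empty. *)
Definition branch t i (p q : tprog) : tprog :=
  let b s := TSeq rewind (if cell_test t i s then p else q) in
  TSeq (goto t i) (TBr (keep xpred0) (b None) (b (Some false)) (b (Some true))).

Lemma goto_pos_lt t i s m : size s = 4 -> i < 4 ->
  (goto_pos t i s).+1 < size (full_tape (word s) m.+1).
Proof.
by move=> sz_s lt_i; have [_ le_p _] := @runs_goto t i s 0 sz_s lt_i; rewrite size_full_tape; lia.
Qed.

Lemma exec_branch t i p q s s' n : size s = 4 -> i < 4 ->
  exec (if top_is t i s then p else q) s s' n -> exec (branch t i p q) s s' n.+1.
Proof.
move=> sz_s lt_i [sz le_w H]; split=> //; first by lia.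
move=> m N le_N; have [|m' Htr] := H m N; first by lia.
exists m'; have [Hgo le_p Hc] := @runs_goto t i s m sz_s lt_i.
have Hrew := runs_rewind m.+1 le_p.
apply: (@runs_le _ _ _ (size (word s) + 3 + ((goto_pos t i s).+1 + n * (20 * N.+1)).+1)).
  by lia.
apply: runs_seq Hgo _; apply: runs_br; rewrite at_pos_left //; last exact: goto_pos_lt.
rewrite -Hc in Htr.
by rewrite head_at_pos; case: (nth _ _ _) Htr => [[]|] Htr; apply: runs_seq Hrew Htr.
Qed.

Definition while t i (p : tprog) : tprog :=
  TSeq (goto t i) (TSeq
    (TWh (cell_test t i) (keep xpred0) (TSeq rewind (TSeq p (goto t i)))) rewind).

(** The additional unit per round pays for [goto] and [rewind]. *)
Inductive loop t i p : state -> state -> nat -> Prop :=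
| LoopEnd s : top_is t i s = false -> loop t i p s s 1
| LoopStep s1 s2 s3 n m : top_is t i s1 -> exec p s1 s2 n -> loop t i p s2 s3 m ->
    loop t i p s1 s3 (n + m).+1.

Lemma loop_le_word t i p s s' n : loop t i p s s' n ->
  size s' = size s /\ size (word s') <= size (word s) + 2 * n.
Proof.
elim=> {s s' n} [s _|s1 s2 s3 n m _ [sz le_w _] _ [sz' le_w']]; first by split=> //; lia.
by split; [rewrite sz' | lia].
Qed.

Lemma exec_while t i p s s' n : size s = 4 -> i < 4 -> loop t i p s s' n ->
  exec (while t i p) s s' n.+1.
Proof.
move=> sz_s lt_i Hl; have [sz le_w] := loop_le_word Hl.
split=> //; first by lia.
move=> m N le_N; have [Hgo le_p _] := @runs_goto t i s m sz_s lt_i.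
suff [m' Hin] : exists m', runs (TWh (cell_test t i) (keep xpred0) (TSeq rewind (TSeq p (goto t i))))
    (at_pos (full_tape (word s) m.+1) (goto_pos t i s).+1)
    (at_pos (full_tape (word s') m'.+1) (goto_pos t i s')) (n * (20 * N.+1)).
  have [_ le_p' _] := @runs_goto t i s' m' (etrans sz sz_s) lt_i.
  exists m'; apply: runs_le (runs_seq Hgo (runs_seq Hin (runs_rewind _ le_p'))); lia.
have {}le_N : size (word s) + 2 * n <= N by lia.
elim: Hl m sz_s {Hgo sz le_w le_p} le_N => {s s' n} [s Hc|s1 s2 s3 n k Hc [sz le_w Hp] Hl IH] m sz_s le_N.
  have [_ le_p Htest] := @runs_goto t i s m sz_s lt_i.
  exists m; apply: (@runs_le _ _ _ 1); first by lia.
  rewrite -(@at_pos_left (full_tape (word s) m.+1) (goto_pos t i s) xpred0) //; last exact: goto_pos_lt.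
  by apply: runs_wh_end; rewrite head_at_pos Htest.
have [_ le_p Htest] := @runs_goto t i s1 m sz_s lt_i.
have [|m2 Htr] := Hp m N; first by lia.
have [||m3 Hrest] := IH m2; [by rewrite sz | by lia|].
have [Hgo2 le_p2 _] := @runs_goto t i s2 m2 (etrans sz sz_s) lt_i.
exists m3; apply: (@runs_le _ _ _ ((goto_pos t i s1).+1 +
  (n * (20 * N.+1) + (size (word s2) + 3)) + k * (20 * N.+1)).+1); first by lia.
apply: runs_wh Hrest; first by rewrite head_at_pos Htest.
rewrite at_pos_left //; last exact: goto_pos_lt.
by apply: runs_seq (runs_seq Htr Hgo2); apply: runs_rewind.
Qed.

(** The first bit of the input is overwritten by the marker; the branch remembers it and inserts it
    again, which shifts the input by one cell. *)
Definition mark_left_end : tprog :=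
  TBr (fun=> (None, true)) stay (TSeq (TIns false) back) (TSeq (TIns true) back).

Lemma runs_mark_left_end x : exists m,
  runs mark_left_end ([::], somes x) (home x m.+1) (2 * size x + 4).
Proof.
case: x => [|b x].
  by exists 0; apply: runs_br; apply: (@runs_seq _ _ _ ([::], [:: None; None]) _ 1 2);
    [apply: runs_act | apply: (@runs_le _ _ _ 1) => //; apply: runs_act].
have [w [c def_w]] : exists w c, b :: x = rcons w c by case/lastP: x => [|w c]; [exists [::], b | exists (b :: w), c].
exists 0; apply: (@runs_le _ _ _ ((size x).+1 + (1 + (size w).+2)).+1).
  by have := congr1 size def_w; rewrite size_rcons /=; lia.
apply: runs_br.
suff H : runs (TSeq (TIns b) back) ([:: None], somes x) (home (b :: x) 1) ((size x).+1 + (1 + (size w).+2)).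
  by case: b def_w H => def_w H.
rewrite def_w.
apply: runs_seq; first by rewrite -[somes x]cats0; apply: (@runs_ins b x [:: None] 0).
rewrite [rev _ ++ _](_ : _ = rev (None :: somes (rcons w c))); last by rewrite -def_w [RHS]rev_cons cats1.
apply: runs_seq; last by apply: (@runs_rewind (rcons w c) 1 (size w).+1); rewrite size_rcons.
rewrite -[full_tape _ _]/(None :: somes (rcons w c) ++ head None [::] :: behead [::]).
by rewrite -tape_left_end; apply: runs_act.
Qed.

(** Each inserted [false] is the encoding of an empty stack. The three final right moves pass over
    these symbols, since the output is read from the head position. *)
Definition run_stacks (p : tprog) : tprog :=
  TSeq mark_left_end (TSeq (insert_at 0 false) (TSeq (insert_at 0 false) (TSeq (insert_at 0 false)
    (TSeq p (TSeq go_right (TSeq go_right go_right)))))).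

Lemma tm_run_stacks p x y n : exec p [:: [::]; [::]; [::]; x] [:: [::]; [::]; [::]; y] n ->
  exists2 t, t <= 100 * (size x + n + 1) ^ 2 &
    tm_outputs_within (tm_of_code (compile (run_stacks p) 0 (plen (run_stacks p)))) t x y.
Proof.
case=> _ le_w H.
have [m0 H0] := runs_mark_left_end x.
have [m1 H1] := runs_insert [::] false x m0.+1.
have [m2 H2] := runs_insert [::] false (false :: x) m1.+1.
have [m3 H3] := runs_insert [::] false (false :: false :: x) m2.+1.
have [|m4 H4] := H m3 (size x + 3 + 2 * n); first by rewrite /word /=; lia.
have Hr p' : p' < 4 -> runs go_right (at_pos (full_tape ([:: false; false; false] ++ y) m4.+1) p')
    (at_pos (full_tape ([:: false; false; false] ++ y) m4.+1) p'.+1) 1.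
  by move=> lt_p; apply: runs_right; rewrite size_full_tape size_cat /=; lia.
have Htr := runs_seq H0 (runs_seq H1 (runs_seq H2 (runs_seq H3 (runs_seq H4
   (runs_seq (Hr 1 isT) (runs_seq (Hr 2 isT) (Hr 3 isT))))))).
have [t le_t Hout] := tm_of_tprog Htr; exists t.
  apply: leq_trans le_t _; rewrite /= -mulnn; nia.
move: Hout; rewrite /at_pos /= drop0 => -[Hh Ht]; split=> //; rewrite Ht.
by elim: y {H le_w H4 Hr Htr Hh Ht} => //= b y ->.
Qed.

(** * Trees on a stack *)

Definition pour i j : tprog :=
  while false i (branch true i (TSeq (pop i) (push j true)) (TSeq (pop i) (push j false))).

Lemma exec_pour i j s : size s = 4 -> i < 4 -> j < 4 -> i != j ->
  exec (pour i j) s (set_stack (set_stack s i [::]) j (rev (nth [::] s i) ++ nth [::] s j))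
    (4 * size (nth [::] s i) + 2).
Proof.
move=> sz_s lt_i lt_j neq_ij; rewrite addn2; apply: exec_while => //.
move def_x: (nth [::] s i) => x.
elim: x s sz_s def_x => [|b x IHx] s sz_s def_x.
  have -> : set_stack (set_stack s i [::]) j (rev [::] ++ nth [::] s j) = s.
    move: def_x; case: s sz_s => [|x0 [|x1 [|x2 [|x3 []]]]] // _.
    by case: i lt_i neq_ij => [|[|[|[|//]]]] _; case: j lt_j => [|[|[|[|//]]]] _ _ //= ->.
  by apply: LoopEnd; rewrite /top_is def_x.
have Hb : exec (branch true i (TSeq (pop i) (push j true)) (TSeq (pop i) (push j false))) s
    (set_stack (set_stack s i x) j (b :: nth [::] s j)) 3.
  apply: exec_branch => //; rewrite /top_is def_x /=.
  have E : nth [::] s j = nth [::] (set_stack s i x) j by rewrite nth_set_nth /= eq_sym (negPf neq_ij).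
  have sz' : size (set_stack s i x) = 4 by rewrite size_set_nth sz_s (maxn_idPr lt_i).
  by case: b def_x => def_x; apply: (exec_seq (exec_pop _ _ def_x)) => //; rewrite E; apply: exec_push.
have := IHx (set_stack (set_stack s i x) j (b :: nth [::] s j)).
rewrite 2!size_set_nth sz_s (maxn_idPr lt_i) (maxn_idPr lt_j) => /(_ erefl).
rewrite nth_set_nth /= (negPf neq_ij) nth_set_nth /= eqxx => /(_ erefl) H.
have -> : (4 * size (b :: x)).+1 = (3 + (4 * size x).+1).+1 by rewrite /=; lia.
apply: (LoopStep _ Hb); first by rewrite /top_is def_x.
move: H; congr (loop _ _ _ _ _ _).
rewrite nth_set_nth /= eqxx rev_cons cat_rcons.
case: s sz_s {IHx def_x Hb} => [|x0 [|x1 [|x2 [|x3 []]]]] // _.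
by case: i lt_i neq_ij => [|[|[|[|//]]]] _; case: j lt_j => [|[|[|[|//]]]] _ _ //=.
Qed.

Inductive tree := Leaf | Node of tree & tree.

Fixpoint ser (t : tree) : seq bool :=
  if t is Node a b then true :: ser a ++ ser b else [:: false].

Definition tsize t := size (ser t).

Definition move_tree_body d :=
  branch true 3 (TSeq (pop 3) (TSeq (push d true) (push 2 true)))
                (TSeq (pop 3) (TSeq (push d false) (pop 2))).

(* Stack 2 counts the subtrees that remain to be moved. *)
Definition move_tree d := TSeq (push 2 true) (while false 2 (move_tree_body d)).

(** [x] is the stack that receives the tree, number 1 if [d] holds and number 0 otherwise; [n] is
    the counter and [r] the data. *)
Definition st2 (d : bool) x y n r : state := if d then [:: y; x; n; r] else [:: x; y; n; r].

Lemma loop_move_tree (d : bool) t x y c r s n :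
  loop false 2 (move_tree_body d) (st2 d (rev (ser t) ++ x) y (nseq c true) r) s n ->
  loop false 2 (move_tree_body d) (st2 d x y (nseq c.+1 true) (ser t ++ r)) s (5 * tsize t + n).
Proof.
elim: t x c r s n => [|a IHa b IHb] x c r s n H.
  rewrite -[5 * _ + n]/(4 + n).+1; apply: LoopStep H; first by case: (d).
  apply: exec_branch => //; first by case: (d).
  rewrite (_ : top_is _ _ _ = false); last by case: (d).
  apply: (@exec_seq _ _ _ (st2 d x y (nseq c.+1 true) r) _ 1 2).
    by case: (d); apply: (@exec_pop 3 false r).
  apply: (@exec_seq _ _ _ (st2 d (false :: x) y (nseq c.+1 true) r) _ 1 1).
    by case: (d); [apply: (@exec_push 1) | apply: (@exec_push 0)].
  by case: (d); apply: (@exec_pop 2 true).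
have -> : 5 * tsize (Node a b) + n = (4 + (5 * tsize a + (5 * tsize b + n))).+1.
  by rewrite /tsize /= size_cat; lia.
apply: (@LoopStep _ _ _ _ (st2 d (true :: x) y (nseq c.+2 true) (ser a ++ ser b ++ r))).
- by case: (d).
- apply: exec_branch => //; first by case: (d).
  rewrite (_ : top_is _ _ _ = true); last by case: (d).
  rewrite /= -catA.
  apply: (@exec_seq _ _ _ (st2 d x y (nseq c.+1 true) (ser a ++ ser b ++ r)) _ 1 2).
    by case: (d); apply: (@exec_pop 3 true).
  apply: (@exec_seq _ _ _ (st2 d (true :: x) y (nseq c.+1 true) (ser a ++ ser b ++ r)) _ 1 1).
    by case: (d); [apply: (@exec_push 1) | apply: (@exec_push 0)].
  by case: (d); apply: (@exec_push 2).
apply: IHa; apply: IHb; move: H.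
by rewrite /= rev_cons rev_cat catA cat_rcons.
Qed.

Lemma exec_move_tree (d : bool) t x y r :
  exec (move_tree d) (st2 d x y [::] (ser t ++ r)) (st2 d (rev (ser t) ++ x) y [::] r) (5 * tsize t + 3).
Proof.
rewrite addnC -[3]/(1 + 2) -addnA.
apply: (@exec_seq _ _ _ (st2 d x y [:: true] (ser t ++ r))).
  by case: (d); apply: (@exec_push 2).
apply: (@exec_le _ _ _ ((5 * tsize t + 1).+1)); first by lia.
apply: exec_while => //; first by case: (d).
apply: (@loop_move_tree d t x y 0 r); apply: LoopEnd; by case: (d).
Qed.

(** Between operations all data are on stack 3; the other stacks are scratch space and are left
    empty. *)
Definition execD p D D' n := exec p [:: [::]; [::]; [::]; D] [:: [::]; [::]; [::]; D'] n.

Lemma execD_push b D : execD (push 3 b) D (b :: D) 1.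
Proof. exact: (@exec_push 3). Qed.

Lemma execD_pop b D : execD (pop 3) (b :: D) D 1.
Proof. exact: (@exec_pop 3). Qed.

Definition swap := TSeq (move_tree 0) (TSeq (move_tree 1) (TSeq (pour 0 3) (pour 1 3))).

Lemma execD_swap a b r :
  execD swap (ser a ++ ser b ++ r) (ser b ++ ser a ++ r) (10 * (tsize a + tsize b) + 10).
Proof.
apply: (@exec_le _ _ _ ((5 * tsize a + 3) + ((5 * tsize b + 3) + ((4 * tsize a + 2) + (4 * tsize b + 2))))).
  by lia.
apply: exec_seq; first exact: (@exec_move_tree false a [::] [::]).
apply: exec_seq; first exact: (@exec_move_tree true b [::] (rev (ser a) ++ [::])).
rewrite /st2 !cats0 /tsize -(size_rev (ser a)) -(size_rev (ser b)).
have := @exec_pour 0 3 [:: rev (ser a); rev (ser b); [::]; r] erefl isT isT isT.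
have := @exec_pour 1 3 [:: [::]; rev (ser b); [::]; ser a ++ r] erefl isT isT isT.
by rewrite /set_stack /= !revK => H2 H1; apply: exec_seq H1 H2.
Qed.

Definition dup_back :=
  while false 0 (branch true 0 (TSeq (pop 0) (TSeq (push 3 true) (push 1 true)))
                               (TSeq (pop 0) (TSeq (push 3 false) (push 1 false)))).

Lemma exec_dup_back x y r :
  exec dup_back [:: x; y; [::]; r] [:: [::]; rev x ++ y; [::]; rev x ++ r] (5 * size x + 2).
Proof.
rewrite addn2; apply: exec_while => //.
elim: x y r => [|b x IHx] y r; first exact: LoopEnd.
have -> : (5 * size (b :: x)).+1 = (4 + (5 * size x).+1).+1 by rewrite /=; lia.
apply: (@LoopStep _ _ _ _ [:: x; b :: y; [::]; b :: r]) => //; last first.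
  by rewrite rev_cons !cat_rcons; apply: IHx.
apply: exec_branch => //; rewrite /top_is /=.
by case: b; apply: (@exec_seq _ _ _ [:: x; y; [::]; r] _ 1 2);
  [apply: (@exec_pop 0 true) | apply: (@exec_seq _ _ _ [:: x; y; [::]; true :: r] _ 1 1);
    [apply: (@exec_push 3) | apply: (@exec_push 1)]
  | apply: (@exec_pop 0 false) | apply: (@exec_seq _ _ _ [:: x; y; [::]; false :: r] _ 1 1);
    [apply: (@exec_push 3) | apply: (@exec_push 1)]].
Qed.

(** After [dup_back] the second copy lies on stack 1 in the order of [ser a]. Pouring it directly
    would reverse it, hence the detour over stack 0. *)
Definition dup := TSeq (move_tree 0) (TSeq dup_back (TSeq (pour 1 0) (pour 0 3))).

Lemma execD_dup a r : execD dup (ser a ++ r) (ser a ++ ser a ++ r) (20 * tsize a + 10).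
Proof.
apply: (@exec_le _ _ _ ((5 * tsize a + 3) + ((5 * tsize a + 2) + ((4 * tsize a + 2) + (4 * tsize a + 2))))).
  by lia.
apply: exec_seq; first exact: (@exec_move_tree false a [::] [::]).
have H := exec_dup_back (rev (ser a)) [::] r.
rewrite size_rev revK cats0 in H.
rewrite /st2 cats0; apply: exec_seq H _.
have := @exec_pour 1 0 [:: [::]; ser a; [::]; ser a ++ r] erefl isT isT isT.
have := @exec_pour 0 3 [:: rev (ser a); [::]; [::]; ser a ++ r] erefl isT isT isT.
by rewrite /set_stack /= size_rev !revK cats0 => H2 H1; apply: exec_seq H1 H2.
Qed.

Definition drop_tree := TSeq (move_tree 0) (while false 0 (pop 0)).

Lemma execD_drop a r : execD drop_tree (ser a ++ r) r (10 * tsize a + 10).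
Proof.
apply: (@exec_le _ _ _ ((5 * tsize a + 3) + (2 * tsize a).+2)); first by lia.
apply: exec_seq; first exact: (@exec_move_tree false a [::] [::]).
apply: exec_while => //; rewrite /st2 cats0 /tsize -(size_rev (ser a)).
elim: (rev _) => [|b x IHx]; first exact: LoopEnd.
have -> : (2 * size (b :: x)).+1 = (1 + (2 * size x).+1).+1 by rewrite /=; lia.
by apply: LoopStep IHx => //; apply: (@exec_pop 0 b).
Qed.

(** No program is empty, so a push followed by a pop stands for the empty word. *)
Definition push_word w := foldr (fun b p => TSeq p (push 3 b)) (TSeq (push 3 true) (pop 3)) w.

Lemma exec_push_word w x y n r :
  exec (push_word w) [:: x; y; n; r] [:: x; y; n; w ++ r] (size w + 2).
Proof.
elim: w => [|b w IHw] /=.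
  apply: (@exec_seq _ _ _ [:: x; y; n; true :: r] _ 1 1); first exact: (@exec_push 3 true).
  exact: (@exec_pop 3 true).
apply: (@exec_le _ _ _ ((size w + 2) + 1)); first by lia.
by apply: exec_seq IHw _; apply: (@exec_push 3 b).
Qed.

(** * Polynomial-time functions *)

Class Rep (A : Type) := rep : A -> tree.
#[global] Hint Mode Rep ! : typeclass_instances.

Definition sz {A} {RA : Rep A} (a : A) : nat := tsize (rep a).

(** The base is at least 2, so a larger exponent absorbs constants, sums and products. *)
Definition polyb {A} {RA : Rep A} (t : A -> nat) : Prop :=
  exists k, forall a, t a <= (sz a).+2 ^ k.

(** The rest [r] of the stack must survive. This frame condition lets a function run while other
    values wait below its argument. *)
Definition polytime {A B} {RA : Rep A} {RB : Rep B} (f : A -> B) : Prop :=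
  exists p t, polyb t /\ forall a r, execD p (ser (rep a) ++ r) (ser (rep (f a)) ++ r) (t a).

Lemma leq_expl m n e : m <= n -> m ^ e <= n ^ e.
Proof. by case: e => // e; rewrite leq_exp2r. Qed.

Section PolyBounds.
Context {A : Type} {RA : Rep A}.
Implicit Types s t : A -> nat.

Lemma polyb_le s t : (forall a, s a <= t a) -> polyb t -> polyb s.
Proof. by move=> le_st [k Hk]; exists k => a; apply: leq_trans (Hk a). Qed.

Lemma polyb_const c : polyb (fun _ : A => c).
Proof.
exists c => a; apply: leq_trans (ltnW (ltn_expl c (isT : 1 < 2))) _.
exact: leq_expl.
Qed.

Lemma polyb_sz : polyb (@sz A RA).
Proof. by exists 1 => a; rewrite expn1; lia. Qed.

Lemma polyb_mul s t : polyb s -> polyb t -> polyb (fun a => s a * t a).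
Proof. by move=> [j Hj] [k Hk]; exists (j + k) => a; rewrite expnD leq_mul. Qed.

Lemma polyb_add s t : polyb s -> polyb t -> polyb (fun a => s a + t a).
Proof.
move=> Hs Ht; apply: (@polyb_le _ (fun a => (s a).+1 * (t a).+1)); first by move=> a; nia.
have S (u : A -> nat) : polyb u -> polyb (fun a => (u a).+1).
  move=> [j Hj]; exists j.+1 => a; rewrite expnS.
  have : 0 < (sz a).+2 ^ j by rewrite expn_gt0.
  move=> X_gt0; apply: (@leq_trans (2 * (sz a).+2 ^ j)); last by rewrite leq_mul2r orbT.
  by have := Hj a; lia.
by apply: polyb_mul; apply: S.
Qed.

Lemma polyb_exp t k : polyb t -> polyb (fun a => t a ^ k).
Proof. by move=> [j Hj]; exists (j * k) => a; rewrite expnM leq_expl. Qed.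

End PolyBounds.

Ltac polyb_tac := repeat first
  [ assumption | exact: polyb_const | exact: polyb_sz
  | apply: polyb_exp | apply: polyb_mul | apply: polyb_add ].

(** [exec] limits the growth of the word to twice the cost. *)
Lemma pt_size {A B} {RA : Rep A} {RB : Rep B} (f : A -> B) :
  polytime f -> polyb (fun a => sz (f a)).
Proof.
move=> [p [t [Ht Hp]]]; apply: (@polyb_le _ _ _ (fun a => sz a + 2 * t a)).
  move=> a; have [_ + _] := Hp a [::]; rewrite /word /sz /tsize /= !cats0; lia.
by apply: polyb_add; [apply: polyb_sz | apply: polyb_mul => //; apply: polyb_const].
Qed.

Lemma polyb_comp A B {RA : Rep A} {RB : Rep B} (f : A -> B) t :
  polyb t -> polyb (fun a => sz (f a)) -> polyb (fun a => t (f a)).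
Proof.
move=> [k Hk] Hf; apply: (polyb_le (fun a => Hk (f a))).
apply: polyb_exp; apply: (polyb_le (t := fun a => sz (f a) + 2)); first by move=> a; lia.
by apply: polyb_add => //; apply: polyb_const.
Qed.

#[export] Instance Rep_prod A B {RA : Rep A} {RB : Rep B} : Rep (A * B) :=
  fun ab => Node (rep ab.1) (rep ab.2).

#[export] Instance Rep_seq A {RA : Rep A} : Rep (seq A) :=
  fun l => foldr (fun x t => Node (rep x) t) Leaf l.

#[export] Instance Rep_unit : Rep unit := fun=> Leaf.

(* Booleans and naturals are lists of units, so that the list operations apply to them. *)
#[export] Instance Rep_bool : Rep bool := fun b => rep (nseq b tt).

#[export] Instance Rep_nat : Rep nat := fun n => rep (nseq n tt).

Lemma tsize_gt0 t : 0 < tsize t.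
Proof. by case: t. Qed.

Lemma tsize_Node a b : tsize (Node a b) = (tsize a + tsize b).+1.
Proof. by rewrite /tsize /= size_cat. Qed.

Lemma sz_pair A B {RA : Rep A} {RB : Rep B} (a : A) (b : B) : sz (a, b) = (sz a + sz b).+1.
Proof. exact: tsize_Node. Qed.

Lemma sz_cons A {RA : Rep A} (a : A) l : sz (a :: l) = (sz a + sz l).+1.
Proof. exact: tsize_Node. Qed.

Lemma sz_nil A {RA : Rep A} : sz ([::] : seq A) = 1.
Proof. by []. Qed.

Lemma sz_nat n : sz n = (2 * n).+1.
Proof.
rewrite /sz /rep /Rep_nat; elim: n => // n IHn.
by rewrite [nseq _ _]/= [rep _]/= tsize_Node IHn /tsize /=; lia.
Qed.

Lemma sz_bool (b : bool) : sz b = (2 * b).+1.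
Proof. by rewrite -sz_nat. Qed.

Lemma sz_gt0 A {RA : Rep A} (a : A) : 0 < sz a.
Proof. exact: tsize_gt0. Qed.

Lemma size_le_sz A {RA : Rep A} (l : seq A) : size l <= sz l.
Proof. by elim: l => // a l IHl; rewrite sz_cons /=; lia. Qed.

Section Closure.
Context {A B C : Type} {RA : Rep A} {RB : Rep B} {RC : Rep C}.

Lemma pt_same_rep (f : A -> B) : (forall a, rep (f a) = rep a) -> polytime f.
Proof.
move=> Hf; exists (TSeq (push 3 true) (pop 3)), (fun=> 2); split; first exact: polyb_const.
by move=> a r; rewrite Hf; apply: (@exec_seq _ _ _ _ _ 1 1); [apply: execD_push | apply: execD_pop].
Qed.

Lemma pt_const (b : B) : polytime (fun _ : A => b).
Proof.
exists (TSeq drop_tree (push_word (ser (rep b)))), (fun a => 10 * sz a + 10 + (sz b + 2)); split.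
  by polyb_tac.
by move=> a r; apply: exec_seq; [apply: execD_drop | apply: exec_push_word].
Qed.

Lemma pt_comp (f : A -> B) (g : B -> C) : polytime g -> polytime f -> polytime (fun a => g (f a)).
Proof.
move=> [q [u [Hu Hq]]] Hf; have := pt_size Hf; case: Hf => [p [t [Ht Hp]]] Hsz.
exists (TSeq p q), (fun a => t a + u (f a)); split.
  by apply: polyb_add => //; apply: (polyb_comp Hu).
by move=> a r; apply: exec_seq (Hp _ _) (Hq _ _).
Qed.

(** The frame condition is used twice: [f] runs above a second copy of the argument, then [g] above
    the result of [f]. The final push supplies the symbol of the node. *)
Lemma pt_pair (f : A -> B) (g : A -> C) :
  polytime f -> polytime g -> polytime (fun a => (f a, g a)).
Proof.
move=> Hf Hg; have := pt_size Hf; have := pt_size Hg.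
case: Hf => [p [t [Ht Hp]]]; case: Hg => [q [u [Hu Hq]]] Hszg Hszf.
exists (TSeq dup (TSeq p (TSeq swap (TSeq q (TSeq swap (push 3 true)))))),
  (fun a => (20 * sz a + 10) + (t a + ((10 * (sz (f a) + sz a) + 10) +
     (u a + ((10 * (sz (g a) + sz (f a)) + 10) + 1))))); split.
  by polyb_tac.
move=> a r; apply: exec_seq (execD_dup _ _) _; apply: exec_seq (Hp _ _) _.
apply: exec_seq (execD_swap _ _ _) _; apply: exec_seq (Hq _ _) _.
apply: exec_seq (execD_swap _ _ _) _; 
rewrite -[ser (rep (f a, g a))]/(true :: ser (rep (f a)) ++ ser (rep (g a))) cat_cons -catA.
exact: execD_push.
Qed.

Lemma pt_fst : polytime (@fst A B).
Proof.
exists (TSeq (pop 3) (TSeq swap drop_tree)),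
  (fun a => 1 + ((10 * (sz a.1 + sz a.2) + 10) + (10 * sz a.2 + 10))); split.
  apply: (@polyb_le _ _ _ (fun a => 1 + ((10 * sz a + 10) + (10 * sz a + 10)))).
    by move=> [a b]; rewrite sz_pair /=; lia.
  by polyb_tac.
move=> [a b] r; rewrite /= -catA; apply: exec_seq (execD_pop _ _) _.
by apply: exec_seq (execD_swap _ _ _) (execD_drop _ _).
Qed.

Lemma pt_snd : polytime (@snd A B).
Proof.
exists (TSeq (pop 3) drop_tree), (fun a => 1 + (10 * sz a.1 + 10)); split.
  apply: (@polyb_le _ _ _ (fun a => 1 + (10 * sz a + 10))).
    by move=> [a b]; rewrite sz_pair /=; lia.
  by polyb_tac.
by move=> [a b] r; rewrite /= -catA; apply: exec_seq (execD_pop _ _) (execD_drop _ _).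
Qed.

(** A nonempty list has the same representation as the pair of its head and tail. Hence
    [(x :: l, b)] already is the representation of [(x, l, b)]; the outer symbol is only lifted to
    expose the one to be tested. *)
Lemma pt_list_case (f : B -> C) (g : A * seq A * B -> C) : polytime f -> polytime g ->
  polytime (fun s : seq A * B => if s.1 is x :: l then g (x, l, s.2) else f s.2).
Proof.
move=> [p [t [Ht Hp]]] [q [u [Hu Hq]]].
exists (TSeq (pop 3) (branch true 3 (TSeq (push 3 true) q) (TSeq (pop 3) p))),
  (fun s => 1 + (if s.1 is x :: l then 1 + u (x, l, s.2) else 1 + t s.2).+1); split.
  move: Ht Hu => [j Hj] [k Hk].
  apply: (@polyb_le _ _ _ (fun s => 3 + ((sz s + 2) ^ j + (sz s + 2) ^ k))).
    move=> [[|x l] b] /=; rewrite !addn2.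
      have : t b <= (sz (([::] : seq A), b)).+2 ^ j.
        by apply: leq_trans (Hj b) _; apply: leq_expl; rewrite sz_pair; lia.
      by move: (_ ^ j) (_ ^ k) => X Y; lia.
    have : u (x, l, b) <= (sz (x :: l, b)).+2 ^ k.
      by apply: leq_trans (Hk _) _; apply: leq_expl; rewrite !sz_pair sz_cons; lia.
    by move: (_ ^ k) (_ ^ j) => X Y; lia.
  by polyb_tac.
move=> [[|x l] b] r /=.
  apply: exec_seq (execD_pop _ _) _; apply: exec_branch => //.
  by apply: exec_seq (execD_pop _ _) (Hp _ _).
rewrite -!catA; apply: exec_seq (execD_pop _ _) _; apply: exec_branch => //.
apply: exec_seq (execD_push _ _) _.
by have := Hq (x, l, b) r; rewrite /= -catA -catA.
Qed.

End Closure.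

Lemma sz_cat A {RA : Rep A} (l1 l2 : seq A) : (sz (l1 ++ l2)).+1 = sz l1 + sz l2.
Proof. by elim: l1 => [|x l1 IH] //=; rewrite !sz_cons; lia. Qed.

Section Fold.
Context {A B : Type} {RA : Rep A} {RB : Rep B}.
Variable F : A * B -> B.

Let foldF l b := foldl (fun b x => F (x, b)) b l.

Let step (s : A * seq A * B) : seq A * B := (s.1.2, F (s.1.1, s.2)).

(** Between rounds the [true] of the pair is missing, so that the top bit of stack 3 tells whether
    the list is empty. A round restores it for [p] and removes it afterwards. *)
Let body p := TSeq (push 3 true) (TSeq p (pop 3)).

Fixpoint fold_time (t : A * seq A * B -> nat) l b : nat :=
  if l is x :: l' then (1 + (t (x, l', b) + 1) + fold_time t l' (F (x, b))).+1 else 1.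

Lemma fold_time_le t M l b :
  (forall l1 x l2, l = l1 ++ x :: l2 -> t (x, l2, foldF l1 b) <= M) ->
  fold_time t l b <= 1 + size l * (M + 3).
Proof.
elim: l b => //= x l IHl b le_M.
have le_T : fold_time t l (F (x, b)) <= 1 + size l * (M + 3).
  by apply: IHl => l1 y l2 def_l; apply: (le_M (x :: l1)); rewrite def_l.
by have := le_M [::] x l erefl; rewrite /= mulSn; lia.
Qed.

Lemma loop_foldl p t l b r :
  (forall a r, execD p (ser (rep a) ++ r) (ser (rep (step a)) ++ r) (t a)) ->
  loop true 3 (body p) [:: [::]; [::]; [::]; ser (rep l) ++ ser (rep b) ++ r]
    [:: [::]; [::]; [::]; false :: ser (rep (foldF l b)) ++ r] (fold_time t l b).
Proof.
move=> Hp; elim: l b => [|x l IHl] b; first exact: LoopEnd.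
rewrite [fold_time _ _ _]/=; apply: LoopStep (IHl _) => //.
apply: exec_seq (execD_push _ _) _; apply: exec_seq (execD_pop true _).
have := Hp (x, l, b) r; rewrite /= -!catA.
done.
Qed.

(** The cost of a round depends on the current accumulator. As the size bound holds for all lists,
    it applies to the prefix folded so far, and the total is the length times a common bound. *)
Lemma pt_foldl : polytime F ->
  (exists k, forall l b, sz (foldF l b) <= (sz l + sz b).+2 ^ k) ->
  polytime (fun s : seq A * B => foldF s.1 s.2).
Proof.
move=> HF [k Hk].
have [p [t [[j Ht] Hp]]] : polytime step.
  apply: pt_pair; first by apply: (pt_comp pt_snd); apply: pt_fst.
  by apply: (pt_comp HF); apply: pt_pair; [apply: (pt_comp pt_fst); apply: pt_fst | apply: pt_snd].
exists (TSeq (pop 3) (TSeq (while true 3 (body p)) (pop 3))).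
exists (fun s => 1 + ((fold_time t s.1 s.2).+1 + 1)); split.
  apply: (@polyb_le _ _ _ (fun s => 4 + sz s * ((2 * sz s + (sz s + 2) ^ k + 4) ^ j + 3))); last first.
    by polyb_tac.
  move=> [l b] /=; set M := (_ ^ j).
  have le_l : size l <= sz (l, b) by rewrite sz_pair; have := @size_le_sz _ RA l; lia.
  suff le_T : fold_time t l b <= 1 + size l * (M + 3).
    by have := leq_mul le_l (leqnn (M + 3)); move: le_T; move: (size l * _) (sz _ * _) => X Y; lia.
  apply: fold_time_le => l1 x l2 def_l; apply: leq_trans (Ht _) _; rewrite /M; apply: leq_expl.
  rewrite !sz_pair.
  have le1 : sz (foldF l1 b) <= ((sz l + sz b).+1 + 2) ^ k.
    apply: leq_trans (Hk l1 b) _; apply: leq_expl.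
    by have := @sz_cat _ RA l1 (x :: l2); rewrite -def_l; have := @sz_gt0 _ (Rep_seq (RA := RA)) (x :: l2); lia.
  have := @sz_cat _ RA l1 (x :: l2); rewrite -def_l sz_cons; have := @sz_gt0 _ (Rep_seq (RA := RA)) l1.
  by move: (_ ^ k) le1 => X; lia.
move=> [l b] r; rewrite [ser (rep (l, b))]/= [rep _]/= cat_cons -catA.
apply: exec_seq (execD_pop true _) _; apply: exec_seq (execD_pop false _).
by apply: exec_while => //; apply: loop_foldl.
Qed.

End Fold.

Section Combinators.
Context {X A B C : Type} {RX : Rep X} {RA : Rep A} {RB : Rep B} {RC : Rep C}.

Lemma pt_ext (f g : A -> B) : f =1 g -> polytime f -> polytime g.
Proof. by move=> Efg [p [t [Ht Hp]]]; exists p, t; split=> // a r; rewrite -Efg. Qed.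

Lemma pt_id : polytime (fun a : A => a).
Proof. exact: pt_same_rep. Qed.

Lemma pt_fst_of (f : X -> A * B) : polytime f -> polytime (fun a => (f a).1).
Proof. by move=> Hf; apply: (pt_comp pt_fst Hf). Qed.

Lemma pt_snd_of (f : X -> A * B) : polytime f -> polytime (fun a => (f a).2).
Proof. by move=> Hf; apply: (pt_comp pt_snd Hf). Qed.

Lemma pt_cons (f : X -> A) (g : X -> seq A) :
  polytime f -> polytime g -> polytime (fun a => f a :: g a).
Proof.
move=> Hf Hg; have H : polytime (fun p : A * seq A => p.1 :: p.2) by apply: pt_same_rep.
exact: (pt_comp H (pt_pair Hf Hg)).
Qed.

Lemma pt_match (l : X -> seq A) (f : X -> B) (g : X -> A -> seq A -> B) :
  polytime l -> polytime f -> polytime (fun p : X * (A * seq A) => g p.1 p.2.1 p.2.2) ->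
  polytime (fun a => if l a is x :: l' then g a x l' else f a).
Proof.
move=> Hl Hf Hg.
have Hg' : polytime (fun s : A * seq A * X => g s.2 s.1.1 s.1.2).
  apply: (pt_comp Hg (f := fun s => (s.2, s.1))); apply: pt_pair; first exact: pt_snd.
  exact: pt_fst.
have H := pt_comp (pt_list_case Hf Hg') (pt_pair Hl (pt_same_rep (f := id) (fun=> erefl))).
exact: H.
Qed.
End Combinators.

Section Fold.
Context {X A B : Type} {RX : Rep X} {RA : Rep A} {RB : Rep B}.

(* The size hypothesis rules out accumulators that grow exponentially. *)
Lemma pt_fold (F : X -> A -> B -> B) (l : X -> seq A) (b : X -> B) :
  polytime (fun p : X * A * B => F p.1.1 p.1.2 p.2) ->
  (exists k, forall a x b, sz (F a x b) <= sz b + (sz a + sz x).+2 ^ k) ->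
  polytime l -> polytime b -> polytime (fun a => foldl (fun b x => F a x b) (b a) (l a)).
Proof.
move=> HF [k Hk] Hl Hb.
(* The parameter [a] of [F] travels with the accumulator, since the step function of [pt_foldl] has
   no parameter. *)
pose G (p : A * (X * B)) : X * B := (p.2.1, F p.2.1 p.1 p.2.2).
have EG a b' l' : foldl (fun b x => G (x, b)) (a, b') l' = (a, foldl (fun b x => F a x b) b' l').
  by elim: l' b' => //= x l' IH b'; rewrite -IH.
have HG : polytime (fun s : seq A * (X * B) => foldl (fun b x => G (x, b)) s.2 s.1).
  apply: pt_foldl.
    apply: pt_pair; first by apply: pt_fst_of; apply: pt_snd.
    apply: (pt_comp HF (f := fun p : A * (X * B) => (p.2.1, p.1, p.2.2))); apply: pt_pair; last by apply: pt_snd_of; apply: pt_snd.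
    by apply: pt_pair; [apply: pt_fst_of; apply: pt_snd | apply: pt_fst].
  (* The growth is at most the length of the list times [Z ^ k]; two further factors [Z] cover the
     length and the added constants. *)
  exists k.+2 => l' [a b']; rewrite EG !sz_pair.
  have H1 l1 M : sz l1 <= M ->
      sz (foldl (fun b x => F a x b) b' l1) <= sz b' + size l1 * (sz a + M).+2 ^ k.
    elim: l1 b' => [|x l1 IH] b' le_M /=; first by rewrite addn0.
    move: le_M; rewrite sz_cons => le_M.
    apply: leq_trans (IH _ _) _; first by lia.
    have := Hk a x b'; have : (sz a + sz x).+2 ^ k <= (sz a + M).+2 ^ k by apply: leq_expl; lia.
    by rewrite mulSn; move: (_ ^ k) (_ ^ k) => P Q; lia.
  have := H1 l' _ (leqnn _); move: (foldl _ _ _) => b2.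
  have le_l : size l' <= sz l' by apply: size_le_sz.
  set Z := (sz l' + (sz a + sz b').+1).+2.
  have : (sz a + sz l').+2 ^ k <= Z ^ k by apply: leq_expl; rewrite /Z; lia.
  have Zk : 0 < Z ^ k by rewrite expn_gt0.
  rewrite !expnS; move: (_ ^ k) Zk (_ ^ k) => P P_gt0 Q le_QP le_b2.
  have : size l' * Q <= sz l' * P by apply: leq_mul.
  have : sz b' + sz l' * P <= (sz a + sz b' + sz l') * P by nia.
  have : ((sz a + sz b' + sz l') + 3) * P <= Z * (Z * P) by rewrite /Z; nia.
  nia.
apply: (pt_ext (f := fun a => (foldl (fun b x => G (x, b)) (a, b a) (l a)).2)).
  by move=> a; rewrite EG.
apply: pt_snd_of; apply: (pt_comp HG (f := fun a => (l a, (a, b a)))).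
by apply: pt_pair => //; apply: pt_pair => //; apply: pt_id.
Qed.
End Fold.

Lemma pt_nat_of_units {X} {RX : Rep X} (f : X -> seq unit) :
  polytime f -> polytime (fun a => size (f a)).
Proof.
move=> Hf; apply: (pt_comp (g := size) _ Hf); apply: pt_same_rep => l.
by rewrite /rep /Rep_nat; congr rep; elim: l => //= -[] l ->.
Qed.

Lemma pt_units_of_nat {X} {RX : Rep X} (f : X -> nat) :
  polytime f -> polytime (fun a => nseq (f a) tt).
Proof. by move=> Hf; apply: (pt_comp (g := fun n => nseq n tt) _ Hf); apply: pt_same_rep. Qed.

Lemma pt_units_of_bool {X} {RX : Rep X} (f : X -> bool) :
  polytime f -> polytime (fun a => nseq (f a) tt).
Proof. by move=> Hf; apply: (pt_comp (g := fun b : bool => nseq b tt) _ Hf); apply: pt_same_rep. Qed.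

(** * Lists, booleans and unary arithmetic *)

Section Basic.
Context {X A B : Type} {RX : Rep X} {RA : Rep A} {RB : Rep B}.

Lemma pt_if (b : X -> bool) (f g : X -> A) :
  polytime b -> polytime f -> polytime g -> polytime (fun a => if b a then f a else g a).
Proof.
move=> Hb Hf Hg; apply: (pt_ext (f := fun a => if nseq (b a) tt is _ :: _ then f a else g a)).
  by move=> a; case: (b a).
apply: pt_match (pt_units_of_bool Hb) Hg _.
by apply: (pt_comp Hf (f := fst)); apply: pt_fst.
Qed.

Lemma pt_head x0 (l : X -> seq A) : polytime l -> polytime (fun a => head x0 (l a)).
Proof.
move=> Hl; apply: pt_match => //; first exact: pt_const.
by apply: pt_fst_of; apply: pt_snd.
Qed.

Lemma pt_behead (l : X -> seq A) : polytime l -> polytime (fun a => behead (l a)).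
Proof.
move=> Hl; apply: (pt_ext (f := fun a => if l a is _ :: l' then l' else [::])).
  by move=> a; case: (l a).
apply: pt_match => //; first exact: pt_const.
by apply: pt_snd_of; apply: pt_snd.
Qed.

Lemma pt_nilp (l : X -> seq A) : polytime l -> polytime (fun a => nilp (l a)).
Proof.
move=> Hl; apply: (pt_ext (f := fun a => if l a is _ :: _ then false else true)).
  by move=> a; case: (l a).
by apply: pt_match => //; apply: pt_const.
Qed.

End Basic.

Section Booleans.
Context {X : Type} {RX : Rep X}.

Lemma pt_negb (b : X -> bool) : polytime b -> polytime (fun a => ~~ b a).
Proof. by move=> Hb; apply: pt_if => //; apply: pt_const. Qed.

Lemma pt_andb (b c : X -> bool) : polytime b -> polytime c -> polytime (fun a => b a && c a).
Proof. by move=> Hb Hc; apply: pt_if => //; apply: pt_const. Qed.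

Lemma pt_orb (b c : X -> bool) : polytime b -> polytime c -> polytime (fun a => b a || c a).
Proof. by move=> Hb Hc; apply: pt_if => //; apply: pt_const. Qed.

Lemma pt_S (f : X -> nat) : polytime f -> polytime (fun a => (f a).+1).
Proof.
move=> Hf; apply: (pt_ext (f := fun a => size (tt :: nseq (f a) tt))).
  by move=> a; rewrite /= size_nseq.
by apply: pt_nat_of_units; apply: pt_cons; [apply: pt_const | apply: pt_units_of_nat].
Qed.

Lemma pt_pred (f : X -> nat) : polytime f -> polytime (fun a => (f a).-1).
Proof.
move=> Hf; apply: (pt_ext (f := fun a => size (behead (nseq (f a) tt)))).
  by move=> a; rewrite size_behead size_nseq.
by apply: pt_nat_of_units; apply: pt_behead; apply: pt_units_of_nat.
Qed.

End Booleans.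

Lemma pt_iter {X A : Type} {RX : Rep X} {RA : Rep A} (n : X -> nat) (F : X -> A -> A)
    (b : X -> A) :
  polytime (fun p : X * A => F p.1 p.2) ->
  (exists k, forall a b, sz (F a b) <= sz b + (sz a).+2 ^ k) ->
  polytime n -> polytime b -> polytime (fun a => iter (n a) (F a) (b a)).
Proof.
move=> HF [k Hk] Hn Hb.
apply: (pt_ext (f := fun a => foldl (fun b _ => F a b) (b a) (nseq (n a) tt))).
  by move=> a; elim: (n a) (b a) => //= m IH c; rewrite IH -iterSr.
apply: (pt_fold (F := fun a _ b => F a b) _ _ (pt_units_of_nat Hn) Hb).
  by apply: (pt_comp HF (f := fun p : X * unit * A => (p.1.1, p.2))); apply: pt_pair;
    [apply: pt_fst_of; apply: pt_fst | apply: pt_snd].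
exists k => a u c; apply: leq_trans (Hk a c) _; rewrite leq_add2l; apply: leq_expl; lia.
Qed.

Section Arithmetic.
Context {X : Type} {RX : Rep X}.

Lemma pt_add (f g : X -> nat) : polytime f -> polytime g -> polytime (fun a => f a + g a).
Proof.
move=> Hf Hg; apply: (pt_ext (f := fun a => iter (f a) succn (g a))).
  by move=> a; rewrite iter_succn addnC.
apply: pt_iter => //; first by apply: pt_S; apply: pt_snd.
exists 1 => a b; rewrite !sz_nat; lia.
Qed.

Lemma pt_sub (f g : X -> nat) : polytime f -> polytime g -> polytime (fun a => f a - g a).
Proof.
move=> Hf Hg; apply: (pt_ext (f := fun a => iter (g a) predn (f a))).
  by move=> a; rewrite iter_predn.
apply: pt_iter => //; first by apply: pt_pred; apply: pt_snd.
exists 1 => a b; rewrite !sz_nat; lia.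
Qed.
End Arithmetic.

Lemma pt_mul {X} {RX : Rep X} (f g : X -> nat) :
  polytime f -> polytime g -> polytime (fun a => f a * g a).
Proof.
move=> Hf Hg; apply: (pt_ext (f := fun a => iter (f a) (addn (g a)) 0)).
  by move=> a; rewrite iter_addn_0 mulnC.
have [k Hk] := pt_size Hg.
apply: pt_iter => //; last exact: pt_const.
  by apply: pt_add; [apply: (pt_comp Hg); apply: pt_fst | apply: pt_snd].
exists k => a b; have := Hk a; rewrite !sz_nat; move: (_ ^ k) => Y; lia.
Qed.

Lemma pt_leq {X} {RX : Rep X} (f g : X -> nat) :
  polytime f -> polytime g -> polytime (fun a => f a <= g a).
Proof.
move=> Hf Hg; apply: (pt_ext (f := fun a => nilp (nseq (f a - g a) tt))).
  by move=> a; rewrite /nilp size_nseq.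
by apply: pt_nilp; apply: pt_units_of_nat; apply: pt_sub.
Qed.

Lemma pt_size_of {X A : Type} {RX : Rep X} {RA : Rep A} (l : X -> seq A) :
  polytime l -> polytime (fun a => size (l a)).
Proof.
move=> Hl; apply: (pt_ext (f := fun a => foldl (fun n _ => n.+1) 0 (l a))).
  by move=> a; rewrite -[size _]addn0; elim: (l a) 0 => //= x s IH n; rewrite IH addnS.
apply: (pt_fold (F := fun _ _ n => n.+1)) => //; last exact: pt_const.
  by apply: pt_S; apply: pt_snd.
exists 1 => a x b; rewrite !sz_nat; lia.
Qed.

Lemma pt_catrev {X A : Type} {RX : Rep X} {RA : Rep A} (l m : X -> seq A) :
  polytime l -> polytime m -> polytime (fun a => catrev (l a) (m a)).
Proof.
move=> Hl Hm; apply: (pt_ext (f := fun a => foldl (fun s x => x :: s) (m a) (l a))).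
  by move=> a; elim: (l a) (m a) => //=.
apply: (pt_fold (F := fun _ x s => x :: s)) => //.
  by apply: pt_cons; [apply: pt_snd_of; apply: pt_fst | apply: pt_snd].
exists 1 => a x b; rewrite sz_cons; lia.
Qed.

Lemma pt_rev {X A : Type} {RX : Rep X} {RA : Rep A} (l : X -> seq A) :
  polytime l -> polytime (fun a => rev (l a)).
Proof. by move=> Hl; apply: pt_catrev => //; apply: pt_const. Qed.

(** Converts the additive constants contributed by node symbols into a larger exponent. *)
Lemma exp_slack c k : exists k', forall s, (s + c) ^ k + c <= s.+2 ^ k'.
Proof.
exists (c.+1 * k + c) => s.
have lt_c : c < s.+2 ^ c by apply: leq_trans (ltn_expl c (isT : 1 < 2)) (leq_expl _ _).
have : (s + c) ^ k <= (s.+2 ^ c.+1) ^ k by apply: leq_expl; rewrite expnS; nia.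
have : 0 < (s.+2 ^ c.+1) ^ k by rewrite !expn_gt0.
rewrite expnD expnM; move: (s.+2 ^ c) lt_c (_ ^ k) (_ ^ k) => P ltP Q R; nia.
Qed.

Lemma pt_cat {X A : Type} {RX : Rep X} {RA : Rep A} (l m : X -> seq A) :
  polytime l -> polytime m -> polytime (fun a => l a ++ m a).
Proof.
move=> Hl Hm; apply: (pt_ext (f := fun a => catrev (rev (l a)) (m a))).
  by move=> a; rewrite catrevE revK.
by apply: pt_catrev => //; apply: pt_rev.
Qed.

Lemma pt_rcons {X A : Type} {RX : Rep X} {RA : Rep A} (l : X -> seq A) (x : X -> A) :
  polytime l -> polytime x -> polytime (fun a => rcons (l a) (x a)).
Proof.
move=> Hl Hx; apply: (pt_ext (f := fun a => l a ++ [:: x a])); first by move=> a; rewrite cats1.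
by apply: pt_cat => //; apply: pt_cons => //; apply: pt_const.
Qed.

Lemma pt_map {X A B : Type} {RX : Rep X} {RA : Rep A} {RB : Rep B}
  (F : X -> A -> B) (l : X -> seq A) :
  polytime (fun p : X * A => F p.1 p.2) -> polytime l -> polytime (fun a => [seq F a x | x <- l a]).
Proof.
move=> HF Hl.
apply: (pt_ext (f := fun a => rev (foldl (fun s x => F a x :: s) [::] (l a)))).
  move=> a; rewrite -[RHS]revK; congr rev; rewrite /rev.
  by elim: (l a) [::] => //= x s IH t; rewrite IH.
have [k Hk] := pt_size HF; have [k' Hk'] := exp_slack 3 k.
apply: pt_rev; apply: (pt_fold (F := fun a x s => F a x :: s)) => //; last exact: pt_const.
  by apply: pt_cons; [apply: (pt_comp HF); apply: pt_fst | apply: pt_snd].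
exists k' => a x b; apply: leq_trans (leq_add (leqnn _) (Hk' _)).
by rewrite sz_cons !addn3; have := Hk (a, x); rewrite sz_pair /=; move: (_ ^ k) => Y; lia.
Qed.

Lemma pt_flatten {X A : Type} {RX : Rep X} {RA : Rep A} (l : X -> seq (seq A)) :
  polytime l -> polytime (fun a => flatten (l a)).
Proof.
move=> Hl; apply: (pt_ext (f := fun a => foldl (fun s x => s ++ x) [::] (l a))).
  move=> a; rewrite -[RHS]cat0s; elim: (l a) [::] => [|x s IH] t /=; first by rewrite cats0.
  by rewrite IH catA.
apply: (pt_fold (F := fun _ x s => s ++ x)) => //; last exact: pt_const.
  by apply: pt_cat; [apply: pt_snd | apply: pt_snd_of; apply: pt_fst].
by exists 1 => a x b; have := @sz_cat _ RA b x; lia.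
Qed.

Lemma pt_nseq {X A : Type} {RX : Rep X} {RA : Rep A} (n : X -> nat) (x : X -> A) :
  polytime n -> polytime x -> polytime (fun a => nseq (n a) (x a)).
Proof.
move=> Hn Hx; apply: (pt_ext (f := fun a => [seq x a | _ <- nseq (n a) tt])).
  by move=> a; rewrite map_nseq.
apply: (pt_map (F := fun a _ => x a)) (pt_units_of_nat Hn).
by apply: (pt_comp Hx); apply: pt_fst.
Qed.

Lemma pt_drop {X A : Type} {RX : Rep X} {RA : Rep A} (n : X -> nat) (l : X -> seq A) :
  polytime n -> polytime l -> polytime (fun a => drop (n a) (l a)).
Proof.
move=> Hn Hl; apply: (pt_ext (f := fun a => iter (n a) behead (l a))).
  by move=> a; elim: (n a) (l a) => [|m IH] [|x s] //; rewrite iterSr IH //; case: (m).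
apply: pt_iter => //; first by apply: pt_behead; apply: pt_snd.
by exists 1 => a [|x b]; rewrite ?sz_cons /=; lia.
Qed.

Lemma pt_nth {X A : Type} {RX : Rep X} {RA : Rep A} x0 (l : X -> seq A) (n : X -> nat) :
  polytime l -> polytime n -> polytime (fun a => nth x0 (l a) (n a)).
Proof.
move=> Hl Hn; apply: (pt_ext (f := fun a => head x0 (drop (n a) (l a)))).
  by move=> a; rewrite -nth0 nth_drop addn0.
by apply: pt_head; apply: pt_drop.
Qed.
(** The list is built from its end; the length of the accumulator shows which number comes next, so
    no separate counter is carried. *)
Lemma pt_iota0 {X} {RX : Rep X} (n : X -> nat) : polytime n -> polytime (fun a => iota 0 (n a)).
Proof.
move=> Hn; apply: (pt_ext (f := fun a => iter (n a) (fun s => n a - (size s).+1 :: s) [::])).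
  move=> a; suff H m : m <= n a ->
      iter m (fun s => n a - (size s).+1 :: s) [::] = iota (n a - m) m by rewrite H // subnn.
  elim: m => //= m IH lt_m; rewrite IH ?size_iota 1?ltnW //=.
  by congr (_ :: iota _ _); lia.
have [k Hk] := pt_size Hn; have [k' Hk'] := exp_slack 2 k.
apply: (pt_iter (F := fun a s => n a - (size s).+1 :: s)) => //; last exact: pt_const.
  apply: pt_cons; last exact: pt_snd.
  by apply: pt_sub; [apply: (pt_comp Hn); apply: pt_fst | apply: pt_S; apply: pt_size_of; apply: pt_snd].
exists k' => a b; apply: leq_trans (leq_add (leqnn _) (Hk' _)).
rewrite sz_cons !addn2.
by have := Hk a; rewrite !sz_nat; move: (_ ^ k) => Y; lia.
Qed.

Lemma pt_iota {X} {RX : Rep X} (m n : X -> nat) :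
  polytime m -> polytime n -> polytime (fun a => iota (m a) (n a)).
Proof.
move=> Hm Hn; apply: (pt_ext (f := fun a => [seq m a + i | i <- iota 0 (n a)])).
  by move=> a; rewrite -iotaDl addn0.
apply: pt_map; last exact: pt_iota0.
by apply: pt_add; [apply: (pt_comp Hm); apply: pt_fst | apply: pt_snd].
Qed.

Lemma pt_filter {X A : Type} {RX : Rep X} {RA : Rep A} (P : X -> A -> bool) (l : X -> seq A) :
  polytime (fun p : X * A => P p.1 p.2) -> polytime l -> polytime (fun a => [seq x <- l a | P a x]).
Proof.
move=> HP Hl; apply: (pt_ext (f := fun a => flatten [seq if P a x then [:: x] else [::] | x <- l a])).
  by move=> a; elim: (l a) => //= x s ->; case: (P a x).
apply: pt_flatten; apply: (pt_map (F := fun a x => if P a x then [:: x] else [::])) => //.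
apply: pt_if => //; last exact: pt_const.
by apply: pt_cons; [apply: pt_snd | apply: pt_const].
Qed.

Lemma pt_rep_eq {X A B : Type} {RX : Rep X} {RA : Rep A} {RB : Rep B} (f : X -> A) (g : X -> B) :
  (forall a, rep (g a) = rep (f a)) -> polytime f -> polytime g.
Proof. by move=> E [p [t [Ht Hp]]]; exists p, t; split=> // a r; rewrite E. Qed.

(* [pt_user], [pt_parse] and [pt_reduce] are redefined as more functions are
   proved polynomial-time; [pt_step] falls back on them in turn. *)
Ltac pt_user := fail.

Ltac pt_step :=
  cbv beta;
  lazymatch goal with
  | |- polytime (fun _ => _) => idtac
  | |- polytime ?f => change (polytime (fun x => f x))
  end;
  match goal with
  | |- polytime (fun x => x) => exact: pt_id
  | |- polytime (fun _ => ?c) => exact: pt_const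
  | |- polytime (fun _ => (_, _)) => apply: pt_pair
  | |- polytime (fun _ => (_).1) => apply: pt_fst_of
  | |- polytime (fun _ => (_).2) => apply: pt_snd_of
  | |- polytime (fun _ => _ :: _) => apply: pt_cons
  | |- polytime (fun _ => if _ then _ else _) => apply: pt_if
  | |- polytime (fun _ => head _ _) => apply: pt_head
  | |- polytime (fun _ => behead _) => apply: pt_behead
  | |- polytime (fun _ => nilp _) => apply: pt_nilp
  | |- polytime (fun _ => ~~ _) => apply: pt_negb
  | |- polytime (fun _ => _ && _) => apply: pt_andb
  | |- polytime (fun _ => _ || _) => apply: pt_orb
  | |- polytime (fun _ => _.+1) => apply: pt_S
  | |- polytime (fun _ => _.-1) => apply: pt_pred
  | |- polytime (fun _ => _ + _) => apply: pt_add
  | |- polytime (fun _ => _ - _) => apply: pt_sub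
  | |- polytime (fun _ => _ * _) => apply: pt_mul
  | |- polytime (fun _ => _ <= _) => apply: pt_leq
  | |- polytime (fun _ => size _) => apply: pt_size_of
  | |- polytime (fun _ => rev _) => apply: pt_rev
  | |- polytime (fun _ => _ ++ _) => apply: pt_cat
  | |- polytime (fun _ => rcons _ _) => apply: pt_rcons
  | |- polytime (fun _ => flatten _) => apply: pt_flatten
  | |- polytime (fun _ => nseq _ _) => apply: pt_nseq
  | |- polytime (fun _ => drop _ _) => apply: pt_drop
  | |- polytime (fun _ => nth _ _ _) => apply: pt_nth
  | |- polytime (fun _ => iota _ _) => apply: pt_iota
  | |- polytime (fun _ => map _ _) => apply: pt_map
  | |- polytime (fun _ => filter _ _) => apply: pt_filter
  | H : polytime ?f |- polytime (fun _ => ?f _) => apply: (pt_comp H)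
  | _ => pt_user
  end.

Ltac pt_tac := repeat pt_step.

Lemma pt_eqbits {X : Type} {RX : Rep X} (u v : X -> seq bool) :
  polytime u -> polytime v -> polytime (fun a => u a == v a).
Proof.
move=> Hu Hv; apply: (pt_ext (f := fun a => (size (u a) <= size (v a)) && ((size (v a) <= size (u a)) &&
  nilp [seq b <- [seq if nth false (u a) i then ~~ nth false (v a) i else nth false (v a) i
     | i <- iota 0 (size (u a))] | b]))).
  move=> a; rewrite andbA -eqn_leq; apply/andP/eqP => [[/eqP sz_uv]|->]; last first.
    split=> //; rewrite /nilp size_filter -leqn0 leqNgt -has_count; apply/hasPn => b /mapP [i _ ->].
    by case: (nth _ _ _).
  rewrite /nilp size_filter -leqn0 leqNgt -has_count => /hasPn H.
  apply: (eq_from_nth (x0 := false)) => // i lt_i.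
  have /H : (if nth false (u a) i then ~~ nth false (v a) i else nth false (v a) i)
      \in [seq if nth false (u a) i then ~~ nth false (v a) i else nth false (v a) i
     | i <- iota 0 (size (u a))].
    by apply: (map_f (fun i => if nth false (u a) i then ~~ nth false (v a) i else nth false (v a) i));
       rewrite mem_iota.
  by case: (nth _ _ _) (nth _ _ _) => [] [].
pt_tac => //.
all: by [apply: (pt_comp Hu); pt_tac | apply: (pt_comp Hv); pt_tac].
Qed.

(** * From polynomial-time functions to Turing machines *)

Definition load : tprog :=
  TSeq (pour 3 0) (TSeq (push 3 false)
    (while false 0 (branch true 0 (TSeq (pop 0) (push_word [:: true; true; false; false]))
                                  (TSeq (pop 0) (push_word [:: true; false]))))).

(** Pouring reverses the input, so the list grows from its last bit. The two words pushed are the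
    symbol of a list node followed by the serialisation of [true] or [false]. *)
Lemma execD_load x : execD load x (ser (rep x)) (14 * size x + 10).
Proof.
apply: (@exec_le _ _ _ ((4 * size x + 2) + (1 + (10 * size x + 1).+1))); first by lia.
apply: exec_seq; first exact: (@exec_pour 3 0 [:: [::]; [::]; [::]; x]).
rewrite /set_stack /= cats0; apply: (@exec_seq _ _ _ [:: rev x; [::]; [::]; [:: false]]).
  exact: (@exec_push 3 false [:: rev x; [::]; [::]; [::]]).
apply: exec_while => //.
have H y z : loop false 0
    (branch true 0 (TSeq (pop 0) (push_word [:: true; true; false; false]))
                   (TSeq (pop 0) (push_word [:: true; false])))
    [:: y; [::]; [::]; ser (rep (z : seq bool))] [:: [::]; [::]; [::]; ser (rep (catrev y z))]
    (10 * size y + 1).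
  elim: y z => [|b y IHy] z; first exact: LoopEnd.
  have -> : 10 * size (b :: y) + 1 = (9 + (10 * size y + 1)).+1 by rewrite /=; lia.
  apply: (LoopStep _ _ (IHy (b :: z))) => //.
  apply: (@exec_le _ _ _ 8) => //; apply: exec_branch => //; rewrite /top_is /=.
  by case: b; [apply: (@exec_le _ _ _ (1 + 6)) => // | apply: (@exec_le _ _ _ (1 + 4)) => //];
    (apply: (@exec_seq _ _ _ [:: y; [::]; [::]; ser (rep z)]);
      first by [apply: (@exec_pop 0 true) | apply: (@exec_pop 0 false)]);
    [apply: (exec_push_word [:: true; true; false; false]) | apply: (exec_push_word [:: true; false])].
by have := H (rev x) [::]; rewrite size_rev catrevE revK cats0.
Qed.

Definition store : tprog :=
  TSeq (while true 3 (TSeq (pop 3) (branch true 3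
      (TSeq (pop 3) (TSeq (pop 3) (TSeq (pop 3) (push 0 true))))
      (TSeq (pop 3) (push 0 false)))))
    (TSeq (pop 3) (pour 0 3)).

Lemma execD_store x : execD store (ser (rep x)) x (11 * size x + 10).
Proof.
pose body := TSeq (pop 3) (branch true 3
      (TSeq (pop 3) (TSeq (pop 3) (TSeq (pop 3) (push 0 true)))) (TSeq (pop 3) (push 0 false))).
apply: (@exec_le _ _ _ ((7 * size x + 1).+1 + (1 + (4 * size x + 2)))); first by lia.
apply: (@exec_seq _ _ _ [:: rev x; [::]; [::]; [:: false]]).
  apply: exec_while => //; rewrite -/body.
  have H y z : loop true 3 body [:: y; [::]; [::]; ser (rep (z : seq bool))]
      [:: catrev z y; [::]; [::]; [:: false]] (7 * size z + 1).
    elim: z y => [|b z IHz] y; first exact: LoopEnd.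
    have -> : 7 * size (b :: z) + 1 = (6 + (7 * size z + 1)).+1 by rewrite /=; lia.
    apply: (LoopStep _ _ (IHz (b :: y))) => //.
    apply: (@exec_seq _ _ _ [:: y; [::]; [::]; ser (rep b) ++ ser (rep z)] _ 1 5).
      exact: (@exec_pop 3 true).
    case: b; apply: (@exec_le _ _ _ 5) => //.
      apply: exec_branch => //.
      apply: (@exec_seq _ _ _ [:: y; [::]; [::]; [:: false, false & ser (rep z)]] _ 1 3).
        exact: (@exec_pop 3 true).
      apply: (@exec_seq _ _ _ [:: y; [::]; [::]; [:: false & ser (rep z)]] _ 1 2).
        exact: (@exec_pop 3 false).
      apply: (@exec_seq _ _ _ [:: y; [::]; [::]; ser (rep z)] _ 1 1).
        exact: (@exec_pop 3 false).
      exact: (@exec_push 0 true).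
    apply: (@exec_le _ _ _ 3) => //; apply: exec_branch => //.
    apply: (@exec_seq _ _ _ [:: y; [::]; [::]; ser (rep z)] _ 1 1); first exact: (@exec_pop 3 false).
    exact: (@exec_push 0 false).
  exact: H.
apply: (@exec_seq _ _ _ [:: rev x; [::]; [::]; [::]]); first exact: (@exec_pop 3 false).
have := @exec_pour 0 3 [:: rev x; [::]; [::]; [::]] erefl isT isT isT.
by rewrite /set_stack /= size_rev revK cats0.
Qed.

Lemma size_sz_bits (x : seq bool) : sz x <= 4 * size x + 1.
Proof. by elim: x => // b x IH; rewrite sz_cons sz_bool /=; case: b; lia. Qed.

Lemma tm_of_pt (h : seq bool -> seq bool) : polytime h ->
  exists M k, forall x, exists2 t, t <= (size x).+2 ^ k & tm_outputs_within M t x (h x).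
Proof.
move=> Hh; have [j Hj] := pt_size Hh; case: Hh => [p [t [[k Hk] Hp]]].
pose n (x : seq bool) := (14 * size x + 10) + (t x + (11 * size (h x) + 10)).
have Hrun x : execD (TSeq load (TSeq p store)) x (h x) (n x).
  apply: exec_seq (execD_load x) _; apply: exec_seq (execD_store (h x)).
  by have := Hp x [::]; rewrite !cats0.
(* [4 * m + 3] bounds [(sz x).+2] for a string [x] of length [m]; the rest collects the costs of
   [load], [p] and [store] in the bound of [tm_run_stacks]. *)
pose Q m := 100 * (m + (14 * m + 10 + ((4 * m + 3) ^ k + (11 * (4 * m + 3) ^ j + 10))) + 1) ^ 2.
have [K HK] : exists K, forall s, Q s <= s.+2 ^ K.
  (* Reading [m] as a unary number makes the closure properties of [polyb] available. The exponent
     is doubled because [(sz s).+2] is [2 * s + 3], at most the square of [s.+2]. *)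
  have [K HK] : polyb (fun m : nat => Q (sz m)) by rewrite /Q; polyb_tac.
  exists (2 * K) => s; apply: leq_trans (_ : _ <= (sz s).+2 ^ K) _.
    apply: leq_trans (HK s); rewrite /Q.
    have le_s : s <= sz s by rewrite sz_nat; lia.
    rewrite leq_mul2l /=; apply: leq_expl.
    have E : 4 * s + 3 <= 4 * sz s + 3 by lia.
    have := leq_expl k E; have := leq_expl j E.
    by move: (_ ^ k) (_ ^ k) (_ ^ j) (_ ^ j) => ? ? ? ?; lia.
  by rewrite expnM; apply: leq_expl; rewrite sz_nat -mulnn; nia.
pose P := run_stacks (TSeq load (TSeq p store)).
exists (tm_of_code (compile P 0 (plen P))), K => x.
have [t' le_t' Hout] := tm_run_stacks (Hrun x); exists t' => //.
apply: leq_trans le_t' _; apply: leq_trans (HK (size x)).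
rewrite leq_mul2l /=; apply: leq_expl; rewrite leq_add2r leq_add2l /n leq_add2l.
have le_x : (sz x).+2 <= 4 * size x + 3 by have := size_sz_bits x; lia.
apply: leq_add; first exact: leq_trans (Hk x) (leq_expl _ le_x).
rewrite leq_add2r leq_mul2l /=; apply: leq_trans (leq_trans (Hj x) (leq_expl _ le_x)).
exact: size_le_sz.
Qed.

(** * Encodings and their decoders *)

(** All gates get the same shape, two tag bits and two numbers, so that building and analysing a
    gate reduces to operations on pairs. *)
Definition gate_code (g : gate) : bool * bool * (nat * nat) :=
  match g with
  | GConst b => (true, true, (nat_of_bool b, 0))
  | GNot i => (true, false, (i, 0))
  | GAnd i j => (false, false, (i, j))
  | GOr i j => (false, true, (i, j))
  end.

#[export] Instance Rep_gate : Rep gate := fun g => rep (gate_code g).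

#[export] Instance Rep_circuit : Rep circuit := fun C => rep (c_in C, c_gates C, c_out C).

Lemma pt_gate_code {X} {RX : Rep X} (g : X -> gate) :
  polytime g -> polytime (fun a => gate_code (g a)).
Proof. exact: pt_rep_eq. Qed.

Lemma pt_GConst {X} {RX : Rep X} (b : X -> bool) : polytime b -> polytime (fun a => GConst (b a)).
Proof.
move=> Hb; apply: (pt_rep_eq (f := fun a => (true, true, (b a, 0)))) => //.
by pt_tac.
Qed.

Lemma pt_GNot {X} {RX : Rep X} (i : X -> nat) : polytime i -> polytime (fun a => GNot (i a)).
Proof. by move=> Hi; apply: (pt_rep_eq (f := fun a => (true, false, (i a, 0)))) => //; pt_tac. Qed.

Lemma pt_GAnd {X} {RX : Rep X} (i j : X -> nat) :
  polytime i -> polytime j -> polytime (fun a => GAnd (i a) (j a)).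
Proof. by move=> Hi Hj; apply: (pt_rep_eq (f := fun a => (false, false, (i a, j a)))) => //; pt_tac. Qed.

Lemma pt_GOr {X} {RX : Rep X} (i j : X -> nat) :
  polytime i -> polytime j -> polytime (fun a => GOr (i a) (j a)).
Proof. by move=> Hi Hj; apply: (pt_rep_eq (f := fun a => (false, true, (i a, j a)))) => //; pt_tac. Qed.

Lemma pt_gate_match {X A} {RX : Rep X} {RA : Rep A} (g : X -> gate)
    (fc : X -> bool -> A) (fn : X -> nat -> A) (fa fo : X -> nat -> nat -> A) :
  polytime g -> polytime (fun p : X * bool => fc p.1 p.2) -> polytime (fun p : X * nat => fn p.1 p.2) ->
  polytime (fun p : X * (nat * nat) => fa p.1 p.2.1 p.2.2) ->
  polytime (fun p : X * (nat * nat) => fo p.1 p.2.1 p.2.2) ->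
  polytime (fun a => match g a with
               | GConst b => fc a b | GNot i => fn a i
               | GAnd i j => fa a i j | GOr i j => fo a i j end).
Proof.
move=> Hg Hc Hn Ha Ho; pose c a := gate_code (g a); have Hcode : polytime c by apply: pt_gate_code.
apply: (pt_ext (f := fun a => if (c a).1.1
   then (if (c a).1.2 then fc a (0 < (c a).2.1) else fn a (c a).2.1)
   else (if (c a).1.2 then fo a (c a).2.1 (c a).2.2 else fa a (c a).2.1 (c a).2.2))).
  by move=> a; rewrite /c; case: (g a) => [[]|i|i j|i j].
pt_tac => //.
- by apply: (pt_comp Hc (f := fun a => (a, 0 < (c a).2.1))); pt_tac.
- by apply: (pt_comp Hn (f := fun a => (a, (c a).2.1))); pt_tac.
- by apply: (pt_comp Ho (f := fun a => (a, (c a).2))); pt_tac.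
- by apply: (pt_comp Ha (f := fun a => (a, (c a).2))); pt_tac.
Qed.

Lemma pt_Circuit {X} {RX : Rep X} (n : X -> nat) gs os :
  polytime n -> polytime gs -> polytime os -> polytime (fun a => Circuit (n a) (gs a) (os a)).
Proof. by move=> Hn Hg Ho; apply: (pt_rep_eq (f := fun a => (n a, gs a, os a))) => //; pt_tac. Qed.

Lemma pt_c_in {X} {RX : Rep X} (C : X -> circuit) : polytime C -> polytime (fun a => c_in (C a)).
Proof.
move=> HC; have H : polytime (fun a => (c_in (C a), c_gates (C a), c_out (C a))) by apply: pt_rep_eq HC.
by apply: (pt_comp (g := fun p => p.1.1) _ H); pt_tac.
Qed.

Lemma pt_c_gates {X} {RX : Rep X} (C : X -> circuit) :
  polytime C -> polytime (fun a => c_gates (C a)).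
Proof.
move=> HC; have H : polytime (fun a => (c_in (C a), c_gates (C a), c_out (C a))) by apply: pt_rep_eq HC.
by apply: (pt_comp (g := fun p => p.1.2) _ H); pt_tac.
Qed.

Lemma pt_c_out {X} {RX : Rep X} (C : X -> circuit) : polytime C -> polytime (fun a => c_out (C a)).
Proof.
move=> HC; have H : polytime (fun a => (c_in (C a), c_gates (C a), c_out (C a))) by apply: pt_rep_eq HC.
by apply: (pt_comp (g := fun p => p.2) _ H); pt_tac.
Qed.

Lemma pt_unary {X} {RX : Rep X} (n : X -> nat) : polytime n -> polytime (fun a => unary (n a)).
Proof. by move=> Hn; rewrite /unary; pt_tac. Qed.

Lemma pt_enc_bits {X} {RX : Rep X} (x : X -> seq bool) :
  polytime x -> polytime (fun a => enc_bits (x a)).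
Proof. by move=> Hx; rewrite /enc_bits; pt_tac. Qed.

Ltac pt_parse := fail.

Ltac pt_user ::=
  match goal with
  | |- polytime (fun _ => GConst _) => apply: pt_GConst
  | |- polytime (fun _ => GNot _) => apply: pt_GNot
  | |- polytime (fun _ => GAnd _ _) => apply: pt_GAnd
  | |- polytime (fun _ => GOr _ _) => apply: pt_GOr
  | |- polytime (fun _ => match _ with GConst _ => _ | GNot _ => _ | GAnd _ _ => _ | GOr _ _ => _ end) =>
      apply: pt_gate_match
  | |- polytime (fun _ => Circuit _ _ _) => apply: pt_Circuit
  | |- polytime (fun _ => c_in _) => apply: pt_c_in
  | |- polytime (fun _ => c_gates _) => apply: pt_c_gates
  | |- polytime (fun _ => c_out _) => apply: pt_c_out
  | |- polytime (fun _ => unary _) => apply: pt_unary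
  | |- polytime (fun _ => enc_bits _) => apply: pt_enc_bits
  | _ => pt_parse
  end.

Lemma pt_enc_circuit : polytime enc_circuit.
Proof.
have H : polytime (fun C => unary (c_in C) ++ unary (size (c_gates C)) ++ flatten (map enc_gate (c_gates C))
  ++ unary (size (c_out C)) ++ flatten (map unary (c_out C))).
  by pt_tac.
exact: H.
Qed.

(** The decoders are total, because [polytime] concerns all strings. Their values matter only on
    encodings, but their size bounds have to hold on every string. *)
Definition lead (s : seq bool) : nat := index false s.
Definition tail (s : seq bool) : seq bool := drop (lead s).+1 s.

Lemma lead_unary n r : lead (unary n ++ r) = n.
Proof. by rewrite /lead /unary cat_rcons; elim: n => //= n ->. Qed.

Lemma tail_unary n r : tail (unary n ++ r) = r.
Proof.
by rewrite /tail lead_unary drop_size_cat // size_rcons size_nseq.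
Qed.

Lemma sz_tail s : sz (lead s) + sz (tail s) <= (sz s).+1.
Proof.
elim: s => [|[] s IH]; first by [].
  move: IH; rewrite /tail /lead /= !sz_nat sz_cons sz_bool; lia.
by rewrite /tail /lead /= drop0 sz_nat sz_cons sz_bool; lia.
Qed.

Lemma pt_lead {X} {RX : Rep X} (s : X -> seq bool) : polytime s -> polytime (fun a => lead (s a)).
Proof.
move=> Hs; apply: (pt_ext (f := fun a =>
  (foldl (fun (p : bool * nat) x => if p.1 && x then (true, p.2.+1) else (false, p.2)) (true, 0) (s a)).2)).
  move=> a; have Hf u n : foldl (fun (p : bool * nat) (x : bool) => if p.1 && x then (true, p.2.+1) else (false, p.2)) (false, n) u
     = (false, n) by elim: u.
  rewrite -[RHS]addn0; elim: (s a) 0 => //= -[] u IH n; rewrite ?Hf //= IH.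
  by rewrite /lead /= addnS.
pt_tac; apply: (pt_fold (F := fun _ x (p : bool * nat) => if p.1 && x then (true, p.2.+1) else (false, p.2))) => //.
- by pt_tac.
- by exists 2 => a x [b n] /=; case: ifP => _; rewrite !sz_pair !sz_bool !sz_nat -mulnn; case: b; nia.
- by pt_tac.
Qed.

Lemma pt_tail {X} {RX : Rep X} (s : X -> seq bool) : polytime s -> polytime (fun a => tail (s a)).
Proof. by move=> Hs; apply: pt_drop => //; apply: pt_S; apply: pt_lead. Qed.

Ltac pt_reduce := fail.

Ltac pt_parse ::=
  match goal with
  | |- polytime (fun _ => lead _) => apply: pt_lead
  | |- polytime (fun _ => tail _) => apply: pt_tail
  | _ => pt_reduce
  end.

Section ParseMany.
Context {A : Type} {RA : Rep A}.
Variables (item : seq bool -> A) (rest : seq bool -> seq bool) (enc : A -> seq bool).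

Definition parse_many m (s : seq bool) : seq A * seq bool :=
  iter m (fun p => (rcons p.1 (item p.2), rest p.2)) ([::], s).

Lemma parse_many_enc l r :
  (forall a r, item (enc a ++ r) = a) -> (forall a r, rest (enc a ++ r) = r) ->
  parse_many (size l) (flatten (map enc l) ++ r) = (l, r).
Proof.
move=> Hi Hr; rewrite /parse_many -[in RHS](cat0s l).
elim: l [::] => [|x l IH] t; first by rewrite cats0.
by rewrite [size _]/= iterSr /= -catA Hi Hr IH cat_rcons.
Qed.

Lemma sz_rcons l (x : A) : sz (rcons l x) = (sz l + sz x).+1.
Proof. by elim: l => [|y l IH] /=; rewrite ?sz_cons ?IH ?sz_nil; lia. Qed.

(** Parsing redistributes the input between the items and the remaining string. With at most [c] of
    overhead per item, the pair grows only by a constant in each round. *)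
Lemma pt_parse_many {X} {RX : Rep X} (m : X -> nat) (s : X -> seq bool) :
  polytime item -> polytime rest -> (exists c, forall s, sz (item s) + sz (rest s) <= sz s + c) ->
  polytime m -> polytime s -> polytime (fun a => parse_many (m a) (s a)).
Proof.
move=> Hi Hr [c Hc] Hm Hs.
apply: (pt_iter (F := fun _ p => (rcons p.1 (item p.2), rest p.2))) => //.
- by pt_tac.
- exists c.+1 => a [l u] /=; rewrite !sz_pair sz_rcons.
  apply: (@leq_trans ((sz l + sz u).+1 + c.+1)); first by have := Hc u; lia.
  rewrite leq_add2l; apply: leq_trans (ltnW (ltn_expl c.+1 (isT : 1 < 2))) _.
  exact: leq_expl.
- by pt_tac.
Qed.
End ParseMany.

Definition gate_of (s : seq bool) : gate :=
  let r := behead (behead s) in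
  if head false s then
    if head false (behead s) then GConst (head false r) else GNot (lead r)
  else if head false (behead s) then GOr (lead r) (lead (tail r)) else GAnd (lead r) (lead (tail r)).

Definition after_gate (s : seq bool) : seq bool :=
  let r := behead (behead s) in
  if head false s then
    if head false (behead s) then behead r else tail r
  else tail (tail r).

Lemma gate_of_enc g r : gate_of (enc_gate g ++ r) = g.
Proof.
by case: g => [b|i|i j|i j]; rewrite /gate_of //= -?catA ?lead_unary // tail_unary lead_unary.
Qed.

Lemma after_gate_enc g r : after_gate (enc_gate g ++ r) = r.
Proof. by case: g => [b|i|i j|i j]; rewrite /after_gate //= -?catA !tail_unary. Qed.

Lemma sz_behead A {RA : Rep A} (s : seq A) : sz (behead s) <= sz s.
Proof. by case: s => // x s; rewrite sz_cons /=; lia. Qed.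

Lemma sz_gate g : sz g = sz (gate_code g).
Proof. by []. Qed.

Lemma sz_gate_of s : sz (gate_of s) + sz (after_gate s) <= sz s + 20.
Proof.
rewrite /gate_of /after_gate.
have H : sz (behead (behead s)) <= sz s by apply: leq_trans (sz_behead _); apply: sz_behead.
move: (behead (behead s)) H => r le_r.
have H1 := sz_tail r; have H2 := sz_tail (tail r); have H3 : sz (behead r) <= sz r by apply: sz_behead.
case: (head false s); case: (head false (behead s)); rewrite sz_gate /= !sz_pair !sz_bool;
  move: H1 H2 H3; rewrite !sz_nat; case: (head false r) => /=; lia.
Qed.

Definition parse_circuit (s : seq bool) : circuit :=
  let p := parse_many gate_of after_gate (lead (tail s)) (tail (tail s)) in
  Circuit (lead s) p.1 (parse_many lead tail (lead p.2) (tail p.2)).1.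

Lemma parse_circuit_enc C : parse_circuit (enc_circuit C) = C.
Proof.
rewrite /parse_circuit /enc_circuit lead_unary !tail_unary lead_unary.
rewrite (parse_many_enc (enc := enc_gate)); [|exact: gate_of_enc|exact: after_gate_enc].
rewrite /= lead_unary tail_unary -[flatten _]cats0.
rewrite (parse_many_enc (enc := unary)); [|exact: lead_unary|exact: tail_unary].
by case: C.
Qed.

Lemma pt_parse_circuit : polytime parse_circuit.
Proof.
have Hg : polytime gate_of by rewrite /gate_of; pt_tac.
have Ha : polytime after_gate by rewrite /after_gate; pt_tac.
pose p s := parse_many gate_of after_gate (lead (tail s)) (tail (tail s)).
have Hp : polytime p.
  by apply: pt_parse_many => //; [exists 20; apply: sz_gate_of | pt_tac | pt_tac].
have H : polytime (fun s => Circuit (lead s) (p s).1 (parse_many lead tail (lead (p s).2) (tail (p s).2)).1).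
  pt_tac => //.
  apply: pt_parse_many; [pt_tac | pt_tac | | pt_tac => // | pt_tac => //].
  by exists 1 => s; rewrite addn1; apply: sz_tail.
exact: H.
Qed.

Definition bits_step (p : seq bool * seq bool) : seq bool * seq bool :=
  if head false p.2 then (rcons p.1 (head false (behead p.2)), behead (behead p.2)) else p.

Definition parse_bits (s : seq bool) : seq bool * seq bool := iter (size s) bits_step ([::], s).

Definition bits_of s := (parse_bits s).1.
Definition after_bits s := behead (parse_bits s).2.

Lemma size_enc_bits x : size (enc_bits x) = (2 * size x).+1.
Proof.
by elim: x => // b x IH; rewrite -[enc_bits _]/[:: true, b & enc_bits x] [LHS]/= IH /=; lia.
Qed.

(** [bits_step] does nothing at the closing [false], so any number of iterations from [size x] on
    gives the same result; the length of the string is such a number. *)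
Lemma parse_bits_enc x r : parse_bits (enc_bits x ++ r) = (x, false :: r).
Proof.
rewrite /parse_bits; have : size x <= size (enc_bits x ++ r).
  by rewrite size_cat size_enc_bits; lia.
move: (size (enc_bits x ++ r)) => m; rewrite -[x in RHS]cat0s; elim: m x [::] => [|m IH] [|b x] t // le_m.
- by rewrite cats0.
- by rewrite iterSr [bits_step _]/= (IH [::]).
by rewrite iterSr [bits_step _]/= IH // cat_rcons.
Qed.

Lemma bits_of_enc x r : bits_of (enc_bits x ++ r) = x.
Proof. by rewrite /bits_of parse_bits_enc. Qed.

Lemma after_bits_enc x r : after_bits (enc_bits x ++ r) = r.
Proof. by rewrite /after_bits parse_bits_enc. Qed.

Lemma sz_bits_step p : sz (bits_step p) <= sz p.
Proof.
case: p => t s; rewrite /bits_step /=; case: ifP => // hd.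
rewrite !sz_pair sz_rcons; case: s hd => [|[] [|b s]] //= _; rewrite ?sz_cons ?sz_nil ?sz_bool; lia.
Qed.

Lemma sz_bits_of s : sz (bits_of s) + sz (after_bits s) <= sz s + 2.
Proof.
have H : sz (parse_bits s) <= sz (([::] : seq bool), s).
  by rewrite /parse_bits; elim: (size s) => //= m; apply: leq_trans; apply: sz_bits_step.
rewrite /bits_of /after_bits; case: (parse_bits s) H => t u; rewrite !sz_pair sz_nil /=.
by have : sz (behead u) <= sz u by [apply: sz_behead]; lia.
Qed.

Lemma pt_parse_bits : polytime parse_bits.
Proof.
apply: (pt_iter (F := fun _ p => bits_step p)).
- by rewrite /bits_step; pt_tac.
- by exists 0 => a b; apply: leq_trans (sz_bits_step b) (leq_addr _ _).
- by apply: pt_size_of; pt_tac.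
- by pt_tac.
Qed.

Lemma pt_bits_of : polytime bits_of.
Proof. by apply: pt_fst_of; apply: pt_parse_bits. Qed.

Lemma pt_after_bits : polytime after_bits.
Proof. by apply: pt_behead; apply: pt_snd_of; apply: pt_parse_bits. Qed.

Definition parse_sol (s : seq bool) : seq (seq bool) :=
  (parse_many bits_of after_bits (lead s) (tail s)).1.

Lemma parse_sol_enc a : parse_sol (enc_lc_sol a) = a.
Proof.
rewrite /parse_sol /enc_lc_sol lead_unary tail_unary -[flatten _]cats0.
by rewrite (parse_many_enc (enc := enc_bits)) //; [apply: bits_of_enc | apply: after_bits_enc].
Qed.

Lemma pt_parse_sol : polytime parse_sol.
Proof.
apply: pt_fst_of; apply: pt_parse_many; [exact: pt_bits_of | exact: pt_after_bits | | | ].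
- by exists 2; apply: sz_bits_of.
- by apply: pt_lead; pt_tac.
- by apply: pt_tail; pt_tac.
Qed.

(** * The reduction *)

(* The predicate circuit [lc_circuit C i] has [i + 2] input blocks of
   [c_in C] bits. It contains a copy of [C] for every block, followed by one
   elimination block for every stage [s <= i] and every input block [j]. *)
Section Wires.
Variables (C : circuit) (i : nat).

Definition copy_wire (j w : nat) : nat :=
  if w.+1 <= c_in C then j * c_in C + w
  else (i + 2) * c_in C + j * size (c_gates C) + (w - c_in C).

Definition copy_gate (j : nat) (g : gate) : gate :=
  match g with
  | GConst b => GConst b
  | GNot u => GNot (copy_wire j u)
  | GAnd u v => GAnd (copy_wire j u) (copy_wire j v)
  | GOr u v => GOr (copy_wire j u) (copy_wire j v)
  end.

Definition elim_start (s j : nat) : nat :=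
  (i + 2) * c_in C + (i + 2) * size (c_gates C) + (s * (i + 2) + j) * (9 * c_in C + 1).

(* The wire of the [k]-th bit of the vector of block [j] at stage [s]. *)
Definition vec_wire (s j k : nat) : nat :=
  if s is s'.+1 then elim_start s' j + 4 * c_in C + 5 * k + 5 else copy_wire j (nth 0 (c_out C) k).

(** Write [c] for the vector of block [s] and [y] for that of block [j]. The constant and the first
    [4 * n] gates compute [pivot_bit]: the wire [st + 4 * k + 4] carries [y_k] if [c_k] is set and
    the wire [st + 4 * k] otherwise. Then five gates per coordinate form [y_k] xor (pivot bit and
    [c_k]), out of or, and, not. This is the origin of the length [9 * n + 1] and of the offsets in
    [vec_wire]. *)
Definition elim_gates (s j : nat) : seq gate :=
  let st := elim_start s j in let n := c_in C in
  GConst false ::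
  flatten [seq [:: GAnd (vec_wire s s k) (vec_wire s j k);
                   GNot (vec_wire s s k);
                   GAnd (st + 4 * k + 2) (st + 4 * k);
                   GOr (st + 4 * k + 1) (st + 4 * k + 3)] | k <- iota 0 n] ++
  flatten [seq [:: GAnd (st + 4 * n) (vec_wire s s k);
                   GOr (vec_wire s j k) (st + 4 * n + 5 * k + 1);
                   GAnd (vec_wire s j k) (st + 4 * n + 5 * k + 1);
                   GNot (st + 4 * n + 5 * k + 3);
                   GAnd (st + 4 * n + 5 * k + 2) (st + 4 * n + 5 * k + 4)] | k <- iota 0 n].

Definition lc_circuit : circuit :=
  Circuit ((i + 2) * c_in C)
    (flatten [seq map (copy_gate j) (c_gates C) | j <- iota 0 (i + 2)] ++
     flatten [seq flatten [seq elim_gates s j | j <- iota 0 (i + 2)] | s <- iota 0 (i + 1)])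
    [:: elim_start i (i + 1) + 4 * c_in C].
End Wires.

Definition reduce_inst (C : circuit) : lc_inst :=
  LCInst (c_in C) [seq lc_circuit C i | i <- iota 0 (c_in C).-1].

(** Searches are written as matches on filtered lists to fit the closure properties. The last
    [ColZero [::]] is a default; [reduce_sol_correct] shows that it is not reached on solutions. *)
Definition reduce_sol (C : circuit) (a : seq (seq bool)) : col_sol :=
  if [seq x <- a | nilp [seq b <- circ_eval C x | b]] is x :: _ then ColZero x
  else if [seq p <- flatten [seq [seq (x, y) | y <- a] | x <- a] |
             ~~ (p.1 == p.2) && (circ_eval C p.1 == circ_eval C p.2)] is p :: _
  then ColPair p.1 p.2 else ColZero [::].

Lemma pt_copy_wire {X} {RX : Rep X} (C : X -> circuit) (i j w : X -> nat) :
  polytime C -> polytime i -> polytime j -> polytime w -> polytime (fun a => copy_wire (C a) (i a) (j a) (w a)).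
Proof. by move=> HC Hi Hj Hw; rewrite /copy_wire; pt_tac. Qed.

Ltac pt_reduce ::=
  match goal with
  | |- polytime (fun _ => copy_wire _ _ _ _) => apply: pt_copy_wire
  end.

Lemma pt_copy_gate {X} {RX : Rep X} (C : X -> circuit) (i j : X -> nat) (g : X -> gate) :
  polytime C -> polytime i -> polytime j -> polytime g -> polytime (fun a => copy_gate (C a) (i a) (j a) (g a)).
Proof. by move=> HC Hi Hj Hg; rewrite /copy_gate; pt_tac. Qed.

Lemma pt_elim_start {X} {RX : Rep X} (C : X -> circuit) (i s j : X -> nat) :
  polytime C -> polytime i -> polytime s -> polytime j -> polytime (fun a => elim_start (C a) (i a) (s a) (j a)).
Proof. by move=> HC Hi Hs Hj; rewrite /elim_start; pt_tac. Qed.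

Ltac pt_reduce ::=
  match goal with
  | |- polytime (fun _ => copy_wire _ _ _ _) => apply: pt_copy_wire
  | |- polytime (fun _ => copy_gate _ _ _ _) => apply: pt_copy_gate
  | |- polytime (fun _ => elim_start _ _ _ _) => apply: pt_elim_start
  end.

Lemma pt_vec_wire {X} {RX : Rep X} (C : X -> circuit) (i s j k : X -> nat) :
  polytime C -> polytime i -> polytime s -> polytime j -> polytime k -> polytime (fun a => vec_wire (C a) (i a) (s a) (j a) (k a)).
Proof.
move=> HC Hi Hs Hj Hk; apply: (pt_ext (f := fun a => if 1 <= s a
  then elim_start (C a) (i a) (s a).-1 (j a) + 4 * c_in (C a) + 5 * k a + 5
  else copy_wire (C a) (i a) (j a) (nth 0 (c_out (C a)) (k a)))).
  by move=> a; case: (s a).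
by pt_tac.
Qed.

Ltac pt_reduce ::=
  match goal with
  | |- polytime (fun _ => copy_wire _ _ _ _) => apply: pt_copy_wire
  | |- polytime (fun _ => copy_gate _ _ _ _) => apply: pt_copy_gate
  | |- polytime (fun _ => elim_start _ _ _ _) => apply: pt_elim_start
  | |- polytime (fun _ => vec_wire _ _ _ _ _) => apply: pt_vec_wire
  end.

Lemma pt_elim_gates {X} {RX : Rep X} (C : X -> circuit) (i s j : X -> nat) :
  polytime C -> polytime i -> polytime s -> polytime j -> polytime (fun a => elim_gates (C a) (i a) (s a) (j a)).
Proof. by move=> HC Hi Hs Hj; rewrite /elim_gates; pt_tac. Qed.

Lemma pt_lc_circuit : polytime (fun p : circuit * nat => lc_circuit p.1 p.2).
Proof. by rewrite /lc_circuit; pt_tac; apply: pt_elim_gates; pt_tac. Qed.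

Lemma pt_reduce_inst : polytime (fun x => enc_lc_inst (reduce_inst (parse_circuit x))).
Proof.
have Hp := pt_parse_circuit; have He := pt_enc_circuit; have Hl := pt_lc_circuit.
rewrite /enc_lc_inst /reduce_inst /=; pt_tac.
all: by apply: (pt_comp Hl (f := fun p => (parse_circuit p.1, p.2))); pt_tac.
Qed.

Lemma pt_circ_eval {X} {RX : Rep X} (C : X -> circuit) (x : X -> seq bool) :
  polytime C -> polytime x -> polytime (fun a => circ_eval (C a) (x a)).
Proof.
move=> HC Hx.
pose W a := foldl (fun ws g => rcons ws (gate_val ws g)) (x a) (c_gates (C a)).
have HW : polytime W.
  apply: (pt_fold (F := fun _ g ws => rcons ws (gate_val ws g))) => //.
  - by rewrite /gate_val; pt_tac.
  - exists 2 => a g ws; rewrite sz_rcons sz_bool -mulnn.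
    by have : 0 < sz a by [apply: sz_gt0]; case: (gate_val _ _); nia.
  - by pt_tac.
have H : polytime (fun a => [seq nth false (W a) o | o <- c_out (C a)]) by pt_tac.
exact: H.
Qed.

Lemma pt_reduce_sol :
  polytime (fun x => enc_col_sol (reduce_sol (parse_circuit (bits_of x)) (parse_sol (after_bits x)))).
Proof.
have Hp := pt_parse_circuit; have Hs := pt_parse_sol; have Hb := pt_bits_of; have Ha := pt_after_bits.
pose C x := parse_circuit (bits_of x); pose a x := parse_sol (after_bits x).
have HC : polytime C by rewrite /C; pt_tac.
have Hsol : polytime a by rewrite /a; pt_tac.
apply: (pt_ext (f := fun x =>
   if [seq y <- a x | nilp [seq b <- circ_eval (C x) y | b]] is y :: _ then false :: enc_bits y
   else if [seq p <- flatten [seq [seq (y, z) | z <- a x] | y <- a x] |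
             ~~ (p.1 == p.2) && (circ_eval (C x) p.1 == circ_eval (C x) p.2)] is p :: _
   then true :: enc_bits p.1 ++ enc_bits p.2 else [:: false; false])).
  by move=> x; rewrite /reduce_sol -/(C x) -/(a x); case: [seq y <- _ | _] => //; case: [seq p <- _ | _].
apply: pt_match.
- by pt_tac; apply: pt_circ_eval; pt_tac.
- apply: pt_match; [ | by pt_tac | by pt_tac].
  by pt_tac; apply: pt_eqbits; pt_tac; apply: pt_circ_eval; pt_tac.
- by pt_tac.
Qed.

(** * Correctness of the circuits *)

Definition run (ws : seq bool) (gs : seq gate) : seq bool :=
  foldl (fun ws g => rcons ws (gate_val ws g)) ws gs.

Lemma nth_run ws gs p : p < size ws -> nth false (run ws gs) p = nth false ws p.
Proof.
elim: gs ws => //= g gs IH ws lt_p; rewrite IH ?nth_rcons ?lt_p // size_rcons.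
exact: ltnW.
Qed.

Fixpoint wf_gates (k : nat) (gs : seq gate) : bool :=
  if gs is g :: gs' then gate_wf k g && wf_gates k.+1 gs' else true.

Lemma wf_gatesE k gs :
  all (fun p => gate_wf (k + p.1) p.2) (zip (iota 0 (size gs)) gs) = wf_gates k gs.
Proof.
rewrite -[in RHS](addn0 k); elim: gs 0 => //= g gs IH m.
by rewrite IH addnS.
Qed.

Lemma wf_gates_cat k gs hs :
  wf_gates k (gs ++ hs) = wf_gates k gs && wf_gates (k + size gs) hs.
Proof. by elim: gs k => [|g gs IH] k /=; rewrite ?addn0 // IH addSnnS andbA. Qed.

Lemma wf_gates_nth k gs t : wf_gates k gs -> t < size gs ->
  gate_wf (k + t) (nth (GConst false) gs t).
Proof.
elim: gs k t => //= g gs IH k [|t] /andP [wf_g wf_gs] lt_t; first by rewrite addn0.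
by rewrite addnS -addSn IH.
Qed.

Lemma gate_val_run ws hs g : gate_wf (size ws) g -> gate_val (run ws hs) g = gate_val ws g.
Proof. by case: g => //= [i lt_i|i j /andP [lt_i lt_j]|i j /andP [lt_i lt_j]]; rewrite !nth_run. Qed.

(** A well-formed gate reads earlier wires only, and these never change afterwards. So the final
    list of wires satisfies all gate equations at once, and circuits can be verified without
    following the evaluation. *)
Lemma nth_run_gate ws gs t : wf_gates (size ws) gs -> t < size gs ->
  nth false (run ws gs) (size ws + t) = gate_val (run ws gs) (nth (GConst false) gs t).
Proof.
elim: gs ws t => //= g gs IH ws t /andP [wf_g wf_gs].
case: t => [_|t lt_t] /=.
  rewrite addn0 nth_run ?size_rcons // nth_rcons ltnn eqxx.
  by symmetry; apply: (@gate_val_run ws (g :: gs)).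
by rewrite -IH ?size_rcons // addSnnS.
Qed.

Section UniformBlocks.
Context {T : Type} (x0 : T).
Variables (F : nat -> seq T) (e : nat).

Lemma flatten_iotaS c :
  flatten [seq F j | j <- iota 0 c.+1] = flatten [seq F j | j <- iota 0 c] ++ F c.
Proof. by rewrite -addn1 iotaD map_cat flatten_cat /= cats0. Qed.

Lemma size_flatten_iota c : (forall j, j < c -> size (F j) = e) ->
  size (flatten [seq F j | j <- iota 0 c]) = c * e.
Proof.
elim: c => // c IH szF; rewrite flatten_iotaS size_cat szF // IH; first by rewrite mulSn addnC.
by move=> j lt_j; apply: szF; apply: ltnW.
Qed.

Lemma nth_flatten_iota c j t : (forall j, j < c -> size (F j) = e) -> j < c -> t < e ->
  nth x0 (flatten [seq F j | j <- iota 0 c]) (j * e + t) = nth x0 (F j) t.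
Proof.
elim: c => // c IH szF lt_j lt_t.
have szF' j' : j' < c -> size (F j') = e by move=> lt_j'; apply: szF; apply: ltnW.
rewrite flatten_iotaS nth_cat size_flatten_iota //.
have [lt_jc|le_cj] := ltnP j c.
  suff -> : j * e + t < c * e by apply: IH.
  by apply: (@leq_trans (j.+1 * e)); [rewrite mulSn; lia | rewrite leq_mul2r lt_jc orbT].
have -> : j = c by lia.
by rewrite ltnNge leq_addr addKn.
Qed.
End UniformBlocks.

Lemma wf_flatten_iota F e k c :
  (forall j, j < c -> size (F j) = e /\ wf_gates (k + j * e) (F j)) ->
  wf_gates k (flatten [seq F j | j <- iota 0 c]).
Proof.
elim: c => // c IH HF; rewrite flatten_iotaS wf_gates_cat IH /=; last first.
  by move=> j lt_j; apply: HF; apply: ltnW.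
rewrite (@size_flatten_iota _ _ e); first by have [] := HF c (ltnSn _).
by move=> j lt_j; have [] := HF j (ltnW lt_j).
Qed.

(** The pivot is the largest index below [n] at which [c] is true; for [c] zero the result is
    [false]. *)
Fixpoint pivot_bit (n : nat) (c y : nat -> bool) : bool :=
  if n is m.+1 then (if c m then y m else pivot_bit m c y) else false.

(** With [v j] the bits of [C(a_j)], this is the bit [k] of [r_s(a_j)]. *)
Fixpoint reduced (n : nat) (v : nat -> nat -> bool) (s j k : nat) : bool :=
  if s is s'.+1 then
    reduced n v s' j k (+) (pivot_bit n (reduced n v s' s') (reduced n v s' j) && reduced n v s' s' k)
  else v j k.

Lemma eq_pivot_bit n c c' y y' : (forall k, k < n -> c k = c' k) -> (forall k, k < n ->
  y k = y' k) ->
  pivot_bit n c y = pivot_bit n c' y'.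
Proof.
elim: n => //= n IH Ec Ey; rewrite Ec // Ey // IH // => k lt_k; [apply: Ec | apply: Ey]; exact: ltnW.
Qed.

Section LCCircuit.
Variables (C : circuit) (i : nat).
Hypotheses (wfC : circuit_wf C) (out_C : size (c_out C) = c_in C).

Let n := c_in C.
Let G := size (c_gates C).
Let inputs := (i + 2) * n.
Let elims := inputs + (i + 2) * G.

Lemma wf_gatesC : wf_gates n (c_gates C).
Proof. by move: wfC => /andP [] ; rewrite wf_gatesE. Qed.

Lemma c_out_lt k : k < n -> nth 0 (c_out C) k < n + G.
Proof. by move=> lt_k; move: wfC => /andP [_ /allP]; apply; rewrite mem_nth ?out_C. Qed.

Lemma copy_wire_lt j w u : j < i + 2 -> w < n + u -> u <= G ->
  copy_wire C i j w < inputs + j * G + u.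
Proof.
move=> lt_j lt_w le_u; rewrite /copy_wire -/n -/G -/inputs; case: ifP => [lt_wn|/negbT]; last first.
  by rewrite -leqNgt; lia.
have : j.+1 * n <= inputs by rewrite leq_mul2r lt_j orbT.
by rewrite mulSn; lia.
Qed.

Lemma copy_wire_lt_elims j w : j < i + 2 -> w < n + G -> copy_wire C i j w < elims.
Proof.
move=> lt_j lt_w; apply: leq_trans (copy_wire_lt lt_j lt_w (leqnn _)) _.
have : j.+1 * G <= (i + 2) * G by rewrite leq_mul2r lt_j orbT.
by rewrite mulSn /elims; lia.
Qed.

Lemma elim_start_le s j s' j' : j < i + 2 -> (s < s') || (s == s') && (j < j') ->
  elim_start C i s j + (9 * n + 1) <= elim_start C i s' j'.
Proof.
move=> lt_j lt_ss'; rewrite /elim_start -/n -/G -addnA leq_add2l -mulSnr leq_mul2r; apply/orP; right.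
case/orP: lt_ss' => [lt_s|/andP [/eqP <- lt_jj]]; last by lia.
have : s.+1 * (i + 2) <= s' * (i + 2) by rewrite leq_mul2r lt_s orbT.
by rewrite mulSn; lia.
Qed.

(** The vectors of a stage are outputs of the previous stage, or of the copies of [C], so they
    precede every elimination block of the stage, whichever [j'] it belongs to. *)
Lemma vec_wire_lt s j k j' : j < i + 2 -> k < n -> vec_wire C i s j k < elim_start C i s j'.
Proof.
case: s => [|s] lt_j lt_k /=.
  apply: leq_trans (copy_wire_lt_elims lt_j (c_out_lt lt_k)) _.
  by rewrite /elim_start /elims; lia.
by apply: leq_trans (@elim_start_le s j s.+1 j' lt_j _); rewrite ?ltnSn // -/n; lia.
Qed.

Lemma size_elim_gates s j : size (elim_gates C i s j) = 9 * n + 1.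
Proof.
by rewrite /= size_cat (@size_flatten_iota _ _ 4) // (@size_flatten_iota _ _ 5) // -/n; lia.
Qed.

Lemma wf_elim_gates s j : s < i + 2 -> j < i + 2 ->
  wf_gates (elim_start C i s j) (elim_gates C i s j).
Proof.
move=> lt_s lt_j; rewrite /elim_gates -/n; set st := elim_start _ _ _ _.
rewrite -cat1s wf_gates_cat wf_gates_cat (@size_flatten_iota _ _ 4) // /=; apply/andP; split.
  apply: (@wf_flatten_iota _ 4) => k lt_k; split=> //=.
  have := @vec_wire_lt s s k j lt_s lt_k; have := @vec_wire_lt s j k j lt_j lt_k.
  by rewrite -/st; lia.
apply: (@wf_flatten_iota _ 5) => k lt_k; split=> //=.
have := @vec_wire_lt s s k j lt_s lt_k; have := @vec_wire_lt s j k j lt_j lt_k.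
by rewrite -/st; lia.
Qed.

Lemma wf_copy_gates j : j < i + 2 -> wf_gates (inputs + j * G) (map (copy_gate C i j) (c_gates C)).
Proof.
move=> lt_j.
suff H gs u : wf_gates (n + u) gs -> u + size gs <= G ->
    wf_gates (inputs + j * G + u) (map (copy_gate C i j) gs).
  by rewrite -[_ + _]addn0; apply: H; rewrite ?addn0 ?wf_gatesC.
elim: gs u => //= g gs IH u /andP [wf_g wf_gs] le_u.
rewrite -addnS IH ?addnS //; last by lia.
have Hc w : w < n + u -> copy_wire C i j w < inputs + j * G + u.
  by move=> lt_w; apply: copy_wire_lt => //; lia.
by case: g wf_g => //= [w|w w'|w w'] => [/Hc|/andP [/Hc -> /Hc]|/andP [/Hc -> /Hc]] ->.
Qed.

Let copies := flatten [seq map (copy_gate C i j) (c_gates C) | j <- iota 0 (i + 2)].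
Let stages := flatten [seq flatten [seq elim_gates C i s j | j <- iota 0 (i + 2)] | s <- iota 0 (i + 1)].

Lemma size_copies : size copies = (i + 2) * G.
Proof. by apply: size_flatten_iota => j _; rewrite size_map. Qed.

Lemma size_stages : size stages = (i + 1) * ((i + 2) * (9 * n + 1)).
Proof.
by apply: size_flatten_iota => s _; apply: size_flatten_iota => j _; apply: size_elim_gates.
Qed.

Lemma wf_lc_gates : wf_gates inputs (copies ++ stages).
Proof.
rewrite wf_gates_cat size_copies; apply/andP; split.
  by apply: (@wf_flatten_iota _ G) => j lt_j; rewrite size_map; split=> //; apply: wf_copy_gates.
apply: (@wf_flatten_iota _ ((i + 2) * (9 * n + 1))) => s lt_s; split.
  by apply: size_flatten_iota => j _; apply: size_elim_gates.
apply: (@wf_flatten_iota _ (9 * n + 1)) => j lt_j; split; first exact: size_elim_gates.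
have -> : inputs + (i + 2) * G + s * ((i + 2) * (9 * n + 1)) + j * (9 * n + 1) = elim_start C i s j.
  by rewrite /elim_start -/n -/G -/inputs; nia.
by apply: wf_elim_gates => //; lia.
Qed.

Lemma wf_lc_circuit : circuit_wf (lc_circuit C i).
Proof.
rewrite /circuit_wf /= wf_gatesE -/copies -/stages -/n -/inputs wf_lc_gates /= andbT.
rewrite size_cat size_copies size_stages.
by rewrite /elim_start -/n -/G -/inputs; nia.
Qed.
Variable x : nat -> seq bool.
Hypothesis size_x : forall j, j < i + 2 -> size (x j) = n.

Let X := flatten [seq x j | j <- iota 0 (i + 2)].
Let W := run X (copies ++ stages).

Lemma size_X : size X = inputs.
Proof. exact: size_flatten_iota. Qed.

Lemma W_input j w : j < i + 2 -> w < n -> nth false W (j * n + w) = nth false (x j) w.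
Proof.
move=> lt_j lt_w; rewrite nth_run; first exact: nth_flatten_iota.
have : j.+1 * n <= inputs by rewrite leq_mul2r lt_j orbT.
by rewrite size_X mulSn; lia.
Qed.

Lemma W_copy_gate j t : j < i + 2 -> t < G -> nth false W (inputs + j * G + t) =
  gate_val W (copy_gate C i j (nth (GConst false) (c_gates C) t)).
Proof.
move=> lt_j lt_t; rewrite -addnA -size_X.
have lt_jt : j * G + t < (i + 2) * G.
  by apply: (@leq_trans (j.+1 * G)); [rewrite mulSn; lia | rewrite leq_mul2r lt_j orbT].
rewrite nth_run_gate; first 1 last.
- by rewrite size_X; apply: wf_lc_gates.
- by rewrite size_cat size_copies; lia.
rewrite nth_cat size_copies lt_jt (@nth_flatten_iota _ _ _ G) //.
  by rewrite (nth_map (GConst false)).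
by move=> j' _; rewrite size_map.
Qed.

Lemma W_elim s j t : s <= i -> j < i + 2 -> t < 9 * n + 1 ->
  nth false W (elim_start C i s j + t) = gate_val W (nth (GConst false) (elim_gates C i s j) t).
Proof.
move=> le_s lt_j lt_t.
have -> : elim_start C i s j + t =
    size X + (size copies + (s * ((i + 2) * (9 * n + 1)) + (j * (9 * n + 1) + t))).
  by rewrite size_X size_copies /elim_start -/n -/G -/inputs mulnDl mulnA; lia.
have lt_jt : j * (9 * n + 1) + t < (i + 2) * (9 * n + 1).
  apply: (@leq_trans (j.+1 * (9 * n + 1))); first by rewrite mulSn; lia.
  by rewrite leq_mul2r lt_j orbT.
have lt_s : s < i + 1 by lia.
have lt_all : s * ((i + 2) * (9 * n + 1)) + (j * (9 * n + 1) + t) < size stages.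
  rewrite size_stages; apply: (@leq_trans (s.+1 * ((i + 2) * (9 * n + 1)))); first by rewrite mulSn; lia.
  by rewrite leq_mul2r lt_s orbT.
rewrite nth_run_gate; first 1 last.
- by rewrite size_X; apply: wf_lc_gates.
- by rewrite size_cat ltn_add2l.
rewrite nth_cat ltnNge leq_addr addKn /= (@nth_flatten_iota _ _ _ ((i + 2) * (9 * n + 1))) //.
  by rewrite (@nth_flatten_iota _ _ _ (9 * n + 1)) // => j' _; apply: size_elim_gates.
by move=> s' _; apply: size_flatten_iota => j' _; apply: size_elim_gates.
Qed.

(** Strong induction on the wire, as the gates of a copy refer to arbitrary earlier wires of the
    same copy. *)
Lemma W_copy j w : j < i + 2 -> w < n + G ->
  nth false W (copy_wire C i j w) = nth false (run (x j) (c_gates C)) w.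
Proof.
move=> lt_j; elim/ltn_ind: w => w IH lt_w; rewrite /copy_wire -/n -/G -/inputs.
case: ifP => [lt_wn|/negbT]; first by rewrite W_input // nth_run // size_x.
rewrite -leqNgt => le_nw; rewrite W_copy_gate //; last by lia.
have wfC' : wf_gates (size (x j)) (c_gates C) by rewrite size_x ?wf_gatesC.
have lt_t : w - n < size (c_gates C) by rewrite -/G; lia.
have := nth_run_gate wfC' lt_t; rewrite size_x // subnKC // => ->.
have := wf_gates_nth wfC' lt_t; rewrite size_x // subnKC //.
by case: (nth _ _ _) => //= [u lt_u|u v /andP [lt_u lt_v]|u v /andP [lt_u lt_v]]; rewrite !IH //; lia.
Qed.

Let red := reduced n (fun j k => nth false (circ_eval C (x j)) k).

Lemma nth_pivot_gates s j k r : k < n -> r < 4 ->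
  nth (GConst false) (elim_gates C i s j) (4 * k + 1 + r) =
  nth (GConst false) [:: GAnd (vec_wire C i s s k) (vec_wire C i s j k);
                         GNot (vec_wire C i s s k);
                         GAnd (elim_start C i s j + 4 * k + 2) (elim_start C i s j + 4 * k);
                         GOr (elim_start C i s j + 4 * k + 1) (elim_start C i s j + 4 * k + 3)] r.
Proof.
move=> lt_k lt_r; rewrite addn1 addSn /elim_gates [nth _ (_ :: _) _]/= nth_cat -/n.
rewrite (@size_flatten_iota _ _ 4) // (_ : _ < _); last by lia.
rewrite [X in nth _ _ X](_ : _ = k * 4 + r); last by lia.
by rewrite (@nth_flatten_iota _ _ _ 4).
Qed.

Lemma nth_xor_gates s j k r : k < n -> r < 5 ->
  nth (GConst false) (elim_gates C i s j) (4 * n + 5 * k + 1 + r) =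
  let b := elim_start C i s j + 4 * n in
  nth (GConst false) [:: GAnd b (vec_wire C i s s k);
                         GOr (vec_wire C i s j k) (b + 5 * k + 1);
                         GAnd (vec_wire C i s j k) (b + 5 * k + 1);
                         GNot (b + 5 * k + 3);
                         GAnd (b + 5 * k + 2) (b + 5 * k + 4)] r.
Proof.
move=> lt_k lt_r; rewrite addn1 addSn /elim_gates [nth _ (_ :: _) _]/= nth_cat -/n.
rewrite (@size_flatten_iota _ _ 4) // ifF; last by lia.
rewrite [X in nth _ _ X](_ : _ = k * 5 + r); last by lia.
by rewrite (@nth_flatten_iota _ _ _ 5).
Qed.

Lemma W_pivot s j : s <= i -> j < i + 2 ->
  nth false W (elim_start C i s j + 4 * n) =
  pivot_bit n (fun k => nth false W (vec_wire C i s s k)) (fun k => nth false W (vec_wire C i s j k)).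
Proof.
move=> le_s lt_j; set st := elim_start _ _ _ _.
suff H m : m <= n -> nth false W (st + 4 * m) = pivot_bit m (fun k => nth false W (vec_wire C i s s k))
    (fun k => nth false W (vec_wire C i s j k)) by apply: H.
elim: m => [|m IH] le_m /=.
  by rewrite W_elim //; lia.
have E r : r < 4 -> nth false W (st + 4 * m + 1 + r) = gate_val W (nth (GConst false)
    (elim_gates C i s j) (4 * m + 1 + r)).
  by move=> lt_r; rewrite -W_elim // -/st; [congr nth | ]; lia.
have := E 0 isT; have := E 1 isT; have := E 2 isT; have := E 3 isT.
rewrite !nth_pivot_gates //= -/st.
have -> : st + 4 * m + 1 + 3 = st + 4 * m.+1 by lia.
have -> : st + 4 * m + 1 + 2 = st + 4 * m + 3 by lia.
have -> : st + 4 * m + 1 + 1 = st + 4 * m + 2 by lia.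
rewrite addn0 => -> -> -> ->; rewrite IH; last exact: ltnW.
by case: (nth _ _ (vec_wire C i s s m)) => //=; rewrite ?andbT ?orbF.
Qed.

Lemma W_xor s j k : s <= i -> j < i + 2 -> k < n ->
  nth false W (vec_wire C i s.+1 j k) = nth false W (vec_wire C i s j k) (+)
    (nth false W (elim_start C i s j + 4 * n) && nth false W (vec_wire C i s s k)).
Proof.
move=> le_s lt_j lt_k; rewrite [vec_wire C i s.+1 j k]/= -/n; set st := elim_start _ _ _ _.
have E r : r < 5 -> nth false W (st + 4 * n + 5 * k + 1 + r) = gate_val W (nth (GConst false)
    (elim_gates C i s j) (4 * n + 5 * k + 1 + r)).
  by move=> lt_r; rewrite -W_elim // -/st; [congr nth | ]; lia.
have := E 0 isT; have := E 1 isT; have := E 2 isT; have := E 3 isT; have := E 4 isT.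
rewrite !nth_xor_gates //= -/st.
have -> : st + 4 * n + 5 * k + 1 + 4 = st + 4 * n + 5 * k + 5 by lia.
have -> : st + 4 * n + 5 * k + 1 + 3 = st + 4 * n + 5 * k + 4 by lia.
have -> : st + 4 * n + 5 * k + 1 + 2 = st + 4 * n + 5 * k + 3 by lia.
have -> : st + 4 * n + 5 * k + 1 + 1 = st + 4 * n + 5 * k + 2 by lia.
rewrite addn0 => -> -> -> -> ->.
by case: (nth _ _ (vec_wire C i s j k)); case: (nth _ _ (st + _)); case: (nth _ _ _).
Qed.

Lemma W_vec s j k : s <= i + 1 -> j < i + 2 -> k < n ->
  nth false W (vec_wire C i s j k) = red s j k.
Proof.
elim: s j k => [|s IH] j k le_s lt_j lt_k.
  rewrite /= W_copy ?c_out_lt // /red /= /circ_eval (nth_map 0) ?out_C //.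
have le_si : s <= i by lia.
rewrite W_xor // W_pivot // !IH //; try lia.
congr (_ (+) (_ && _)); apply: eq_pivot_bit => k' lt_k'; rewrite IH //; lia.
Qed.

Lemma eval_lc_circuit : circ_eval (lc_circuit C i) X = [:: pivot_bit n (red i i) (red i (i + 1))].
Proof.
rewrite /circ_eval /= -/(run _ _) -/copies -/stages -/W W_pivot //; last by lia.
by congr [:: _]; apply: eq_pivot_bit => k lt_k; rewrite W_vec //; lia.
Qed.
End LCCircuit.

(** * Correctness of the reduction *)

(** Stage [s] involves the first [s] vectors and the vector being reduced, whose index is
    immaterial. This allows any [a_j] with [j > i] to be placed in the last input block. *)
Lemma eq_reduced n v v' s j j' k : (forall t, t < s -> v t =1 v' t) -> v j =1 v' j' ->
  reduced n v s j k = reduced n v' s j' k.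
Proof.
elim: s j j' k => [|s IH] j j' k Ev Ej /=; first exact: Ej.
have Ev' t : t < s -> v t =1 v' t by move=> lt_t; apply: Ev; apply: ltnW.
rewrite (IH j j') // (IH s s) //; last exact: Ev.
by congr (_ (+) (_ && _)); apply: eq_pivot_bit => k' _; apply: IH => //; apply: Ev.
Qed.

Lemma pivot_bitP n (c : nat -> bool) : (exists2 k, k < n & c k) ->
  exists p, [/\ p < n, c p & forall y, pivot_bit n c y = y p].
Proof.
elim: n => [|n IH] [k lt_k ck] //=.
have [cn|ncn] := boolP (c n); first by exists n.
have [|p [lt_p cp Hp]] := IH; last by exists p; split=> //; apply: ltnW.
by exists k => //; move: lt_k; rewrite ltnS leq_eqVlt => /predU1P [Ek|//]; rewrite -Ek ck in ncn.
Qed.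

(* Every stage preserves "nonzero and pairwise distinct" while it confines the
   remaining vectors to one coordinate fewer. *)
Lemma reduced_invariant n (v : nat -> nat -> bool) s :
  (forall j, j <= n -> exists2 k, k < n & v j k) ->
  (forall j j', j < j' <= n -> exists2 k, k < n & v j k != v j' k) ->
  (forall i j j', i < n.-1 -> i < j <= n -> i < j' <= n ->
     pivot_bit n (reduced n v i i) (reduced n v i j) =
     pivot_bit n (reduced n v i i) (reduced n v i j')) ->
  s <= n.-1 ->
  [/\ forall j, s <= j <= n -> exists2 k, k < n & reduced n v s j k,
      forall j j', s <= j < j' -> j' <= n -> exists2 k, k < n & reduced n v s j k != reduced n v s j' k
    & exists K, [/\ uniq K, size K = s, {subset K <= gtn n}
        & forall j k, s <= j <= n -> k \in K -> reduced n v s j k = false]].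
Proof.
move=> Hnz Hneq Hagree; elim: s => [|s IH] le_s.
  split; [exact: Hnz | | by exists [::]].
  by move=> j j' /= lt_j le_j'; apply: Hneq; rewrite lt_j.
have [Hnz_s Hneq_s [K [uniqK szK ltK K0]]] := IH (ltnW le_s).
have [|p [lt_p cp Hp]] := @pivot_bitP n (reduced n v s s); first by apply: Hnz_s; lia.
split=> /=.
(* If the pivot bit is set, the sum with the vector of [s] is nonzero because the two differ;
   otherwise the vector is unchanged. *)
- move=> j le_j; rewrite Hp; case: (reduced n v s j p) => /=.
    have [||k lt_k neq_k] := Hneq_s s j; [lia | lia | exists k => //].
    by move: neq_k; case: (reduced _ _ _ _ _) (reduced _ _ _ _ _) => [] [].
  have [|k lt_k nz_k] := Hnz_s j; first by lia.
  by exists k => //; rewrite addbF.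
- move=> j j' lt_j le_j'; have [||k lt_k neq_k] := Hneq_s j j'; [lia | lia | exists k => //].
  by rewrite (Hagree s j j'); lia.
(* [K] collects the cleared coordinates. The pivot is new because the vector of [s] is 1 there and 0
   on [K]; for the same reason adding this vector leaves the coordinates in [K] cleared. *)
exists (p :: K); split=> /=.
- rewrite uniqK andbT; apply/negP => pK; move: cp; rewrite K0 //; lia.
- by rewrite szK.
- by move=> k; rewrite inE => /predU1P [->|/ltK].
move=> j k le_j; rewrite Hp inE => /predU1P [->|kK].
  by rewrite cp andbT addbb.
by rewrite (K0 j k) ?(K0 s k) ?andbF //; lia.
Qed.

Lemma reduced_contradiction n (v : nat -> nat -> bool) :
  (forall j, j <= n -> exists2 k, k < n & v j k) ->
  (forall j j', j < j' <= n -> exists2 k, k < n & v j k != v j' k) ->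
  (forall i j j', i < n.-1 -> i < j <= n -> i < j' <= n ->
     pivot_bit n (reduced n v i i) (reduced n v i j) =
     pivot_bit n (reduced n v i i) (reduced n v i j')) -> False.
Proof.
move=> Hnz Hneq Hagree; have n_gt0 : 0 < n by have [k] := Hnz 0 (leq0n _); lia.
have [Hnz' Hneq' [K [uniqK szK ltK K0]]] := reduced_invariant Hnz Hneq Hagree (leqnn _).
(* Two distinct coordinates outside [K] would give [n + 1] distinct numbers below [n]. Hence the two
   remaining vectors are both supported on the one coordinate left, and being nonzero they are
   equal. *)
have same j j' p q : n.-1 <= j <= n -> n.-1 <= j' <= n -> p < n -> q < n ->
    reduced n v n.-1 j p -> reduced n v n.-1 j' q -> p = q.
  move=> le_j le_j' lt_p lt_q nz_p nz_q; apply/eqP; apply: contraT => neq_pq.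
  have pK : p \notin K by apply: contraL nz_p => /K0 ->.
  have qK : q \notin K by apply: contraL nz_q => /K0 ->.
  have uniq_pqK : uniq [:: p, q & K] by rewrite /= inE negb_or neq_pq pK qK uniqK.
  have sub : {subset [:: p, q & K] <= iota 0 n}.
    by move=> k; rewrite mem_iota !inE => /or3P [/eqP ->|/eqP ->|/ltK].
  by have := uniq_leq_size uniq_pqK sub; rewrite /= size_iota szK; lia.
have [|k lt_k nz_k] := Hnz' n; first by lia.
have [|k' lt_k' nz_k'] := Hnz' n.-1; first by lia.
have [||q lt_q neq_q] := Hneq' n.-1 n; [lia | lia | ].
have Ek : k' = k by apply: (same n.-1 n) => //; lia.
have [nz_q|z_q] := boolP (reduced n v n.-1 n q).
  have Eq : q = k by apply: (same n n) => //; lia.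
  by move: neq_q; rewrite nz_q Eq -Ek nz_k'.
have nz_q : reduced n v n.-1 n.-1 q by move: neq_q; rewrite (negPf z_q) ; case: (reduced _ _ _ _ _).
have Eq : q = k by apply: (same n.-1 n) => //; lia.
by move: z_q; rewrite Eq nz_k.
Qed.

Lemma reduce_inst_valid C : col_valid C -> lc_valid (reduce_inst C).
Proof.
move=> [wfC szC]; split; first by rewrite size_map size_iota.
move=> i lt_i; rewrite (nth_map 0) ?size_iota // nth_iota //.
by split=> //; apply: wf_lc_circuit.
Qed.

Lemma size_circ_eval C x : size (circ_eval C x) = size (c_out C).
Proof. exact: size_map. Qed.

Lemma reduce_inst_eval C a i j : col_valid C -> lc_rel (reduce_inst C) a ->
  i < (c_in C).-1 -> i < j <= c_in C ->
  circ_eval (nth (Circuit 0 [::] [::]) (lc_P (reduce_inst C)) i) (flatten (take i.+1 a) ++ nth [::] a j) =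
  let red := reduced (c_in C) (fun j k => nth false (circ_eval C (nth [::] a j)) k) in
  [:: pivot_bit (c_in C) (red i i) (red i j)].
Proof.
move=> [wfC szC] [/= sz_a sz_aj _ _] lt_i lt_j.
rewrite (nth_map 0) ?size_iota // nth_iota // add0n.
(* The blocks [0, .., i] hold the fixed prefix and the block [i + 1] the element to be tested. *)
pose x t := if t < i.+1 then nth [::] a t else nth [::] a j.
have -> : flatten (take i.+1 a) ++ nth [::] a j = flatten [seq x t | t <- iota 0 (i + 2)].
  rewrite addn2 flatten_iotaS [x i.+1]/x ltnn -(@map_nth_iota0 _ [::]) ?sz_a; last by lia.
  congr (flatten _ ++ _); apply/eq_in_map => t; rewrite mem_iota /x add0n => /= -> //.
rewrite eval_lc_circuit //; last first.
  by move=> t lt_t; rewrite /x; case: ifP => _; apply: sz_aj; lia.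
congr [:: _]; apply: eq_pivot_bit => k _; apply: eq_reduced => [t lt_t|] k'.
- by rewrite /x ltnS ltnW.
- by rewrite /x leqnn.
- by rewrite /x ltnS ltnW.
by rewrite /x ltnS addn1 ltnn.
Qed.

Lemma nil_filter (T : eqType) (P : pred T) s : [seq x <- s | P x] = [::] ->
  {in s, forall x, ~~ P x}.
Proof. by move=> E x x_s; apply/negP => Px; have := mem_filter P x s; rewrite E Px x_s. Qed.

Lemma mem_filter_head (T : eqType) (P : pred T) s x l : [seq x <- s | P x] = x :: l ->
  P x /\ x \in s.
Proof. by move=> E; apply/andP; rewrite -mem_filter E mem_head. Qed.

Lemma nilp_filter_id (s : seq bool) : nilp [seq b <- s | b] = (s == nseq (size s) false).
Proof. by elim: s => // -[] s. Qed.

Lemma reduce_sol_correct C a : col_valid C -> lc_rel (reduce_inst C) a ->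
  col_rel C (reduce_sol C a).
Proof.
move=> validC rel_a; have [wfC szC] := validC; have [/= sz_a sz_aj uniq_a agree] := rel_a.
have sz_in x : x \in a -> size x = c_in C.
  by case/(nthP [::]) => j; rewrite sz_a => lt_j <-; apply: sz_aj.
rewrite /reduce_sol; case E1: [seq x <- a | _] => [|x l]; last first.
  have [/=] := mem_filter_head E1.
  rewrite nilp_filter_id size_circ_eval szC => /eqP eval_x x_a.
  by split=> //; apply: sz_in.
case E2: [seq p <- _ | _] => [|[x y] l]; last first.
  have [/= /andP [/eqP neq_xy /eqP eq_xy] /allpairsP [[x' y'] [/= x_a y_a [Ex Ey]]]] := mem_filter_head E2.
  by rewrite -Ex -Ey in x_a y_a; split=> //; apply: sz_in.
have mem_a j : j <= c_in C -> nth [::] a j \in a by move=> le_j; apply: mem_nth; rewrite sz_a.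
(* Both searches have come back empty: no value [C(a_j)] is zero and no two coincide, as the
   contradiction requires. *)
exfalso; apply: (@reduced_contradiction (c_in C) (fun j k => nth false (circ_eval C (nth [::] a j)) k)).
- move=> j le_j; have := nil_filter E1 (mem_a j le_j).
  rewrite /nilp size_filter -lt0n -has_count => /hasP [b b_in b_true].
  have [k lt_k Ek] := nthP false b_in; exists k; last by rewrite Ek.
  by rewrite size_circ_eval szC in lt_k.
- move=> j j' /andP [lt_j le_j'].
  have /= := @nil_filter _ _ _ E2 (nth [::] a j, nth [::] a j').
  rewrite allpairs_f ?mem_a ?(leq_trans (ltnW lt_j)) // => /(_ isT).
  rewrite nth_uniq ?sz_a ?ltnS ?(leq_trans (ltnW lt_j)) // ltn_eqF //= => neq_eval.
  have [k|] := @pickP 'I_(c_in C) (fun k => nth false (circ_eval C (nth [::] a j)) k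
       != nth false (circ_eval C (nth [::] a j')) k).
    by exists k.
  move=> H; case/eqP: neq_eval; apply: (eq_from_nth (x0 := false)); rewrite !size_circ_eval // szC.
  by move=> k lt_k; apply/eqP; have /negbT := H (Ordinal lt_k); rewrite negbK.
move=> i j j' lt_i lt_j lt_j'; have := agree i lt_i j j' lt_j lt_j'.
by rewrite (reduce_inst_eval validC rel_a lt_i lt_j) (reduce_inst_eval validC rel_a lt_i lt_j') => -[].
Qed.

(* Long Choice is PPP-hard: Collision polynomial-time reduces to Long Choice. *)
Theorem theorem2 : poly_reduces Collision LongChoice.
Proof.
exists reduce_inst, reduce_sol; split.
(* The machine computes a function of strings; on encodings the decoder is a left inverse, so the
   function agrees there with the reduction. *)
- have [M [k HM]] := tm_of_pt pt_reduce_inst; exists M, k => C _.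
  by have [t le_t] := HM (enc_circuit C); rewrite parse_circuit_enc; exists t.
- have [M [k HM]] := tm_of_pt pt_reduce_sol; exists M, k => C a _ _.
  have [t le_t] := HM (enc_pair (enc_circuit C) (enc_lc_sol a)).
  by rewrite {2}/enc_pair bits_of_enc after_bits_enc parse_circuit_enc parse_sol_enc; exists t.
- exact: reduce_inst_valid.
- exact: reduce_sol_correct.
Qed.
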